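(* Let $k_1\in\mathbb{Z}$ and let initial data in $X_{k_1}$ be given. Then there exists a unique single-interface solution $u$ (with starting index $k_1$ and phase transition times $(t^*_k)_{k\ge k_1}\subset(0,\infty]$) of the lattice equation $\dot u_j=\Delta\Phi'(u_j)$, $j\in\mathbb{Z}$, that attains these initial data at $t=0$. Moreover, this solution satisfies $$\sup_{t\in[0,\infty)}\ \sup_{j\in\mathbb{Z}} u_j(t)\ \le\ D:=\max\Big\{2,\ \sup_{j\in\mathbb{Z}}u_j(0)\Big\},$$ and for all $k\ge k_1$ with $t^*_k<\infty$ we have $$u_{k-1}(t^*_k)>2,\qquad t^*_{k+1}-t^*_k\ \ge\ \ln\sqrt{\frac{D+2}{D-2}},\qquad \dot u_k(t^*_k)=\lim_{t\searrow t^*_k}\dot u_k(t)=4+\lim_{t\nearrow t^*_k}\dot u_k(t)\ \ge\ 4 .$$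
   Context: Set $\Phi'(u)=u-\operatorname{sgn}u$ for $u\in\mathbb{R}$, where $\operatorname{sgn}u=-1$ for $u<0$ and $\operatorname{sgn}u=+1$ for $u\ge 0$ (in particular $\operatorname{sgn}0=+1$). For sequences, $\Delta p_j=p_{j+1}-2p_j+p_{j-1}$, so $\Delta\Phi'(u_j)=\Phi'(u_{j+1})-2\Phi'(u_j)+\Phi'(u_{j-1})$. For $k\in\mathbb{Z}$ define $$X_k=\Big\{u\in\ell^\infty(\mathbb{Z}):\ 0<\inf_{j<k}u_j\le\sup_{j<k}u_j<\infty,\quad -2<\inf_{j\ge k}u_j\le\sup_{j\ge k}u_j<0\Big\}.$$ A continuous function $u:[0,\infty)\to\ell^\infty(\mathbb{Z})$ is called a single-interface solution if there exist $k_1\in\mathbb{Z}$ and a sequence $(t^*_k)_{k\ge k_1}\subset(0,\infty]$ (the phase transition times) such that, with $t^*_{k_1-1}:=0$: (1) for all $k\ge k_1$, either $t^*_{k-1}=\infty$ or $t^*_{k-1}<t^*_k$; (2) $\dot u_j=\Delta\Phi'(u_j)$ for all $j\in\mathbb{Z}$ and all $t\in[0,\infty)\setminus\{t^*_k:k\ge k_1\}$; (3) $u_k(t^*_k)=0$ and $\lim_{t\searrow t^*_k}\dot u_k(t)>0$ for all $k\ge k_1$ with $t^*_k<\infty$; (4) $u$ takes values in $X_k$ on each time interval $(t^*_{k-1},t^*_k)$ with $t^*_{k-1}<\infty$. At a phase transition time, $\dot u_k(t^*_k)$ denotes the value $\Delta\Phi'(u_k(t^*_k))$ of the right-hand side.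 The quantity $\ln\sqrt{(D+2)/(D-2)}$ is read as $+\infty$ if $D=2$. *)

(* Defs.v *)
From Stdlib Require Import Reals ZArith.
From Coquelicot Require Import Coquelicot.
Open Scope R_scope.

Definition sgn (u : R) : R := if Rlt_dec u 0 then -1 else 1.

Definition dPhi (u : R) : R := u - sgn u.

Definition Lap (p : Z -> R) (j : Z) : R :=
  p (j + 1)%Z - 2 * p j + p (j - 1)%Z.

Definition rhs (v : Z -> R) (j : Z) : R := Lap (fun i => dPhi (v i)) j.

Definition inf_on (P : Z -> Prop) (v : Z -> R) : Rbar :=
  Glb_Rbar (fun x => exists j, P j /\ x = v j).

Definition sup_on (P : Z -> Prop) (v : Z -> R) : Rbar :=
  Lub_Rbar (fun x => exists j, P j /\ x = v j).

Definition sup_all (v : Z -> R) : Rbar := sup_on (fun _ => True) v.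

Definition linf_norm (v : Z -> R) : Rbar := sup_all (fun j => Rabs (v j)).

Definition in_linf (v : Z -> R) : Prop := Rbar_lt (linf_norm v) p_infty.

Definition X (k : Z) (v : Z -> R) : Prop :=
  in_linf v /\
  (Rbar_lt 0 (inf_on (fun j => (j < k)%Z) v) /\
   Rbar_le (inf_on (fun j => (j < k)%Z) v) (sup_on (fun j => (j < k)%Z) v) /\
   Rbar_lt (sup_on (fun j => (j < k)%Z) v) p_infty) /\
  (Rbar_lt (-2) (inf_on (fun j => (k <= j)%Z) v) /\
   Rbar_le (inf_on (fun j => (k <= j)%Z) v) (sup_on (fun j => (k <= j)%Z) v) /\
   Rbar_lt (sup_on (fun j => (k <= j)%Z) v) 0).

(* A function on [0,oo) is represented by a function on R whose values at
   negative times are irrelevant: everything below only looks at t >= 0. *)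

Definition continuous_linf (u : R -> Z -> R) : Prop :=
  (forall t, 0 <= t -> in_linf (u t)) /\
  (forall t, 0 <= t -> forall eps : posreal,
     within (fun s => 0 <= s) (locally t)
       (fun s => Rbar_lt (linf_norm (fun j => u s j - u t j)) eps)).

(* Derivative relative to [0,oo): the usual two-sided derivative for t > 0,
   the right derivative at t = 0. *)
Definition deriv_at (f : R -> R) (t v : R) : Prop :=
  filterlim (fun s => (f s - f t) / (s - t))
    (within (fun s => 0 <= s) (locally' t)) (locally v).

(* The derivative of f exists eventually along F and tends to l along F. *)
Definition deriv_lim (F : (R -> Prop) -> Prop) (f : R -> R) (l : R) : Prop :=
  exists g : R -> R,
    F (fun t => deriv_at f t (g t)) /\ filterlim g F (locally l).

(* Only the values T k with k1 <= k are phase transition times; t_prev k is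
   t^*_{k-1}, with the convention t^*_{k1-1} = 0. *)
Definition t_prev (k1 : Z) (T : Z -> Rbar) (k : Z) : Rbar :=
  if Z.eq_dec k k1 then Finite 0 else T (k - 1)%Z.

Record single_interface (k1 : Z) (u : R -> Z -> R) (T : Z -> Rbar) : Prop := {
  si_continuous : continuous_linf u;
  si_pos : forall k, (k1 <= k)%Z -> Rbar_lt 0 (T k);
  si_increasing : forall k, (k1 <= k)%Z ->
    t_prev k1 T k = p_infty \/ Rbar_lt (t_prev k1 T k) (T k);
  si_equation : forall (j : Z) (t : R), 0 <= t ->
    (forall k, (k1 <= k)%Z -> T k <> Finite t) ->
    deriv_at (fun s => u s j) t (rhs (u t) j);
  si_transition : forall (k : Z) (tk : R), (k1 <= k)%Z -> T k = Finite tk ->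
    u tk k = 0 /\
    exists l, deriv_lim (at_right tk) (fun s => u s k) l /\ 0 < l;
  si_phase : forall k, (k1 <= k)%Z -> Rbar_lt (t_prev k1 T k) p_infty ->
    forall t : R, Rbar_lt (t_prev k1 T k) t -> Rbar_lt t (T k) -> X k (u t)
}.

(* For bounded v the supremum is finite, so [real] loses nothing. *)
Definition upper (v : Z -> R) : R := Rmax 2 (real (sup_all v)).

Definition waiting_time (D : R) : Rbar :=
  if Req_EM_T D 2 then p_infty else Finite (ln (sqrt ((D + 2) / (D - 2)))).

(* Main.v *)
Require Import Defs.
From Stdlib Require Import Reals ZArith Lia Lra.
From Coquelicot Require Import Coquelicot.
Open Scope R_scope.

(* Inside a phase, p = Phi'(u) solves the discrete heat equation p' = Lap p, and
   at a transition u is continuous while p_k jumps from 1 to -1.  The bounds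
   -1 <= p <= D - 1 are thus propagated by the comparison principle, which also
   keeps p_j uniformly below 1 for j > k until site k crosses; hence sites cross
   one at a time, in order.  When site k crosses, p_k' >= 0 and p_{k+1} < 1 force
   p_{k-1} > 1, and the jump of p_k adds 4 to the velocity.  Site k+1 can only
   cross after p_k has climbed from -1 back above 1, which takes a time bounded
   below because p_k' <= D - 2 p_k, so the transition times do not accumulate and
   the phases can be glued. *)

(** * Comparison principle *)

(** There are infinitely many sites, so an infimum over [j] need not be attained and no argument at
    a first touching point is available; moreover [X k] demands margins uniform in [j]. The
    integrating factor [exp(2t)], whose 2 is the diagonal of [Lap], settles both: it gives the
    contraction behind the minimum principle and uniform margins [d * exp(-2t)]. No margin can be
    had at the site that has just crossed: it sits at 0, so the state at a transition lies in no
    [X]. The gluing therefore runs through [admissible] states, and a strong minimum principle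
    restores [X] at once afterwards. With the signs frozen each phase is linear, hence an explicit,
    globally defined power series cut off at the first zero of site [k]. Uniqueness comes from the
    same comparison, applied to both signs of the difference of two solutions. *)

Definition Icc (a b t : R) : Prop := a <= t <= b.

(** Precomposing with [clamp] turns continuity relative to [[a, b]] into the two-sided continuity
    that [MVT_gen] and [continuity_ab_maj] ask for also at the endpoints. *)
Definition clamp (a b t : R) : R := Rmax a (Rmin b t).

Lemma clamp_in a b t : a <= b -> Icc a b (clamp a b t).
Proof.
  intros Hab; unfold Icc, clamp; split; [apply Rmax_l|].
  apply Rmax_lub; [exact Hab | apply Rmin_l].
Qed.

Lemma clamp_id a b t : Icc a b t -> clamp a b t = t.
Proof.
  unfold Icc, clamp; intros [H1 H2].
  rewrite Rmin_right by lra; apply Rmax_right; lra.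
Qed.

Lemma clamp_lip a b s t : Rabs (clamp a b s - clamp a b t) <= Rabs (s - t).
Proof.
  unfold clamp, Rmax, Rmin.
  repeat destruct Rle_dec; unfold Rabs; repeat destruct Rcase_abs; lra.
Qed.

Lemma continuous_clamp (f : R -> R) a b t : a <= b ->
  continuous_on (Icc a b) f -> continuous (fun s => f (clamp a b s)) t.
Proof.
  intros Hab Hf.
  apply (filterlim_comp _ _ _ (clamp a b) f _
           (within (Icc a b) (locally (clamp a b t)))).
  2: { apply Hf, clamp_in, Hab. }
  intros P [e HP]; exists e; intros s Hs.
  apply HP; [|apply clamp_in, Hab].
  apply Rle_lt_trans with (2 := Hs); apply clamp_lip.
Qed.

Lemma locally_Ioo a b t : a < t < b -> locally t (fun s => a < s < b).
Proof.
  intros Ht; apply filter_and.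
  - apply (open_gt a); lra.
  - apply (open_lt b); lra.
Qed.

Lemma continuous_on_of_derive (D : R -> Prop) (f df : R -> R) :
  (forall t, is_derive f t (df t)) -> continuous_on D f.
Proof.
  intros Hd t _.
  apply (filterlim_filter_le_1 (F := locally t)).
  - intros P HP; unfold within; apply filter_imp with (2 := HP); auto.
  - apply (ex_derive_continuous f); eexists; apply Hd.
Qed.

Lemma increment_ge (f df : R -> R) (a b : R) : a <= b ->
  continuous_on (Icc a b) f ->
  (forall t, a < t < b -> is_derive f t (df t) /\ 0 <= df t) ->
  f a <= f b.
Proof.
  intros Hab Hc Hd.
  destruct (MVT_gen (fun s => f (clamp a b s)) a b
              (* [MVT_gen] places [c] only in the closed interval, so the candidate derivative is
                 set to 0 at the endpoints, where the sign of [df] is unknown. *)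
              (fun s => if Rlt_dec a s then if Rlt_dec s b then df s else 0 else 0))
    as [c [Hc1 Hc2]].
  - rewrite Rmin_left, Rmax_right by lra; intros x Hx.
    destruct (Rlt_dec a x); [|lra]; destruct (Rlt_dec x b); [|lra].
    apply is_derive_ext_loc with f; [|now apply Hd].
    apply filter_imp with (2 := locally_Ioo a b x Hx).
    intros s Hs; rewrite clamp_id; [reflexivity | unfold Icc; lra].
  - intros x _; apply continuity_pt_filterlim, continuous_clamp; assumption.
  - rewrite !clamp_id in Hc2 by (unfold Icc; lra).
    assert (0 <= (if Rlt_dec a c then if Rlt_dec c b then df c else 0 else 0)).
    { destruct (Rlt_dec a c); [|lra]; destruct (Rlt_dec c b); [|lra]; now apply Hd. }
    nra.
Qed.

Lemma continuous_on_subset (D E : R -> Prop) (f : R -> R) :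
  (forall t, E t -> D t) -> continuous_on D f -> continuous_on E f.
Proof.
  intros HED Hf t Ht.
  apply (filterlim_filter_le_1 (F := within D (locally t))); [|now apply Hf, HED].
  intros P HP; unfold within in *; apply filter_imp with (2 := HP); auto.
Qed.

Lemma continuous_on_plus_c (D : R -> Prop) (f : R -> R) (c : R) :
  continuous_on D f -> continuous_on D (fun s => f s + c).
Proof.
  intros Hf t Ht.
  apply (filterlim_comp_2 (G := locally (f t)) (H := locally c)).
  - now apply Hf.
  - apply filterlim_const.
  - apply (filterlim_plus (f t) c).
Qed.

Lemma continuous_on_exp_mult (D : R -> Prop) (f : R -> R) :
  continuous_on D f -> continuous_on D (fun s => exp (2 * s) * f s).
Proof.
  intros Hf t Ht.
  apply (filterlim_comp_2 (G := locally (exp (2 * t))) (H := locally (f t))).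
  - refine (continuous_on_of_derive D (fun s => exp (2 * s))
              (fun s => 2 * exp (2 * s)) _ t Ht).
    intros s; auto_derive; [trivial | ring].
  - now apply Hf.
  - apply (filterlim_mult (K := R_AbsRing) (exp (2 * t)) (f t)).
Qed.

(** [exp(2t) f] is nondecreasing. For a supersolution of the heat equation, [q' + 2 q] at a site
    dominates the sum of the two neighbours, so the hypothesis only asks that this sum be
    nonnegative. *)
Lemma exp_weight_le (f df : R -> R) (a b : R) : a <= b ->
  continuous_on (Icc a b) f ->
  (forall t, a < t < b -> is_derive f t (df t) /\ 0 <= df t + 2 * f t) ->
  exp (- (2 * (b - a))) * f a <= f b.
Proof.
  intros Hab Hc Hd.
  assert (H : exp (2 * a) * f a <= exp (2 * b) * f b).
  { apply (increment_ge (fun s => exp (2 * s) * f s)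
             (fun s => exp (2 * s) * (df s + 2 * f s))); [exact Hab| |].
    - now apply continuous_on_exp_mult.
    - intros t Ht; destruct (Hd t Ht) as [H1 H2]; split.
      + auto_derive; [eexists; apply H1|].
        change (fun x => f x) with f; rewrite (is_derive_unique _ _ _ H1); ring.
      + apply Rmult_le_pos; [left; apply exp_pos | exact H2]. }
  apply Rmult_le_reg_l with (exp (2 * b)); [apply exp_pos|].
  rewrite <- Rmult_assoc, <- exp_plus.
  replace (2 * b + - (2 * (b - a))) with (2 * a) by ring; exact H.
Qed.

Section Comparison.

Variables (P : Z -> Prop) (a b C : R) (q dq : R -> Z -> R).
Hypothesis cont_q : forall j, P j -> continuous_on (Icc a b) (fun s => q s j).
Hypothesis deriv_q : forall j t, P j -> a < t < b ->
  is_derive (fun s => q s j) t (dq t j) /\ Lap (q t) j <= dq t j.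
Hypothesis bdry_q : forall j t, ~ P j -> Icc a b t -> 0 <= q t j.
Hypothesis init_q : forall j, P j -> 0 <= q a j.
(** Uniform in [j]: this rules out Tychonoff-type solutions, which grow in [j] and violate the
    minimum principle. *)
Hypothesis bound_q : forall j t, Icc a b t -> - C <= q t j.

Let theta := 1 - exp (- (2 * (b - a))).

(* If q >= -M, then exp(2t) (q + M) is nondecreasing, which improves the lower
   bound -M by the factor theta < 1. *)
Lemma comparison_step (M : R) : 0 <= M ->
  (forall j t, Icc a b t -> - M <= q t j) ->
  forall j t, Icc a b t -> - (M * theta) <= q t j.
Proof.
  intros HM Hlow j t Ht.
  assert (Hth : 0 <= theta).
  { unfold theta; enough (exp (- (2 * (b - a))) <= exp 0) by (rewrite exp_0 in *; lra).
    unfold Icc in Ht; destruct (Req_dec a b) as [->|].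
    - right; f_equal; ring.
    - left; apply exp_increasing; lra. }
  destruct (Classical_Prop.classic (P j)) as [Hj|Hj].
  2: { pose proof (bdry_q j t Hj Ht); nra. }
  assert (H : exp (- (2 * (t - a))) * (q a j + M) <= q t j + M).
  { apply (exp_weight_le (fun s => q s j + M) (fun s => dq s j)); [apply Ht| |].
    - apply continuous_on_plus_c.
      apply continuous_on_subset with (2 := cont_q j Hj).
      unfold Icc in *; intros; lra.
    - intros s Hs; assert (Hs' : a < s < b) by (unfold Icc in Ht; lra).
      destruct (deriv_q j s Hj Hs') as [H1 H2]; split.
      + replace (dq s j) with (dq s j + 0) by ring.
        apply (is_derive_plus (fun s => q s j) (fun _ => M)); [exact H1|].
        apply (is_derive_const M).
      + unfold Lap in H2.
        assert (Hs2 : Icc a b s) by (unfold Icc; lra).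
        pose proof (Hlow (j + 1)%Z s Hs2); pose proof (Hlow (j - 1)%Z s Hs2); lra. }
  assert (He : exp (- (2 * (b - a))) <= exp (- (2 * (t - a)))).
  { unfold Icc in Ht; destruct (Req_dec t b) as [->|]; [lra|].
    left; apply exp_increasing; lra. }
  pose proof (exp_pos (- (2 * (b - a)))); pose proof (init_q j Hj).
  unfold theta; nra.
Qed.

(** Iterating [comparison_step] from the crude bound gives [q >= - M theta^n] for every [n], and
    [theta < 1]. *)
Lemma comparison_nonneg j t : Icc a b t -> 0 <= q t j.
Proof.
  intros Ht.
  assert (Hth : 0 <= theta < 1).
  { unfold theta; split; [|pose proof (exp_pos (- (2 * (b - a)))); lra].
    enough (exp (- (2 * (b - a))) <= exp 0) by (rewrite exp_0 in *; lra).
    unfold Icc in Ht; destruct (Req_dec a b) as [->|].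
    - right; f_equal; ring.
    - left; apply exp_increasing; lra. }
  set (M := Rabs C).
  assert (Hn : forall n j t, Icc a b t -> - (M * theta ^ n) <= q t j).
  { intros n; induction n as [|n IH]; intros i s Hs.
    - simpl; pose proof (bound_q i s Hs); pose proof (Rle_abs C); unfold M; lra.
    - replace (M * theta ^ S n) with (M * theta ^ n * theta) by (simpl; ring).
      apply comparison_step; auto.
      apply Rmult_le_pos; [apply Rabs_pos | apply pow_le; lra]. }
  apply Rnot_lt_le; intros Hneg.
  assert (HM : 0 < M + 1) by (pose proof (Rabs_pos C); unfold M; lra).
  (* The divisor is [M + 1] because [M] may vanish. *)
  destruct (pow_lt_1_zero theta) with (y := - q t j / (M + 1)) as [N HN].
  - rewrite Rabs_right; lra.
  - apply Rdiv_lt_0_compat; lra.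
  - specialize (HN N (le_n _)); specialize (Hn N j t Ht).
    rewrite Rabs_right in HN by (apply Rle_ge, pow_le; lra).
    apply (Rmult_lt_compat_r (M + 1)) in HN; [|lra].
    unfold Rdiv in HN; rewrite Rmult_assoc, Rinv_l, Rmult_1_r in HN by lra.
    pose proof (pow_le theta N (proj1 Hth)); nra.
Qed.

(** Quantitative form: once the neighbours are known to be nonnegative, an initial margin loses only
    a factor that is the same for all sites. *)
Lemma comparison_decay j t : P j -> Icc a b t ->
  exp (- (2 * (t - a))) * q a j <= q t j.
Proof.
  intros Hj Ht.
  apply (exp_weight_le (fun s => q s j) (fun s => dq s j)); [apply Ht| |].
  - apply continuous_on_subset with (2 := cont_q j Hj).
    unfold Icc in *; intros; lra.
  - intros s Hs; assert (Hs' : a < s < b) by (unfold Icc in Ht; lra).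
    destruct (deriv_q j s Hj Hs') as [H1 H2]; split; [exact H1|].
    unfold Lap in H2.
    assert (Hs2 : Icc a b s) by (unfold Icc; lra).
    pose proof (comparison_nonneg (j + 1) s Hs2).
    pose proof (comparison_nonneg (j - 1) s Hs2); lra.
Qed.

End Comparison.

(** * Discrete heat flow *)

Fixpoint neighbour_sum (n : nat) (p : Z -> R) (j : Z) : R :=
  match n with
  | O => p j
  | S n => neighbour_sum n p (j + 1) + neighbour_sum n p (j - 1)
  end.

Definition heat_coef (p : Z -> R) (j : Z) (n : nat) : R :=
  neighbour_sum n p j / INR (fact n).

(* Lap = N - 2 with N the sum over both neighbours, so exp(t Lap) =
   exp(-2t) sum_n t^n/n! N^n. *)
Definition heat (p : Z -> R) (t : R) (j : Z) : R :=
  exp (- (2 * t)) * PSeries (heat_coef p j) t.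

Definition bounded_by (C : R) (p : Z -> R) : Prop := forall j, Rabs (p j) <= C.

Lemma neighbour_sum_bound C p n j : bounded_by C p ->
  Rabs (neighbour_sum n p j) <= 2 ^ n * C.
Proof.
  intros Hp; revert j; induction n as [|n IH]; intros j; simpl.
  - rewrite Rmult_1_l; apply Hp.
  - eapply Rle_trans; [apply Rabs_triang|].
    pose proof (IH (j + 1)%Z); pose proof (IH (j - 1)%Z); lra.
Qed.

Lemma heat_coef_bound C p j n x : bounded_by C p ->
  Rabs (heat_coef p j n * x ^ n) <= C * (/ INR (fact n) * (2 * Rabs x) ^ n).
Proof.
  intros Hp; unfold heat_coef, Rdiv.
  rewrite !Rabs_mult, <- RPow_abs, Rpow_mult_distr.
  pose proof (INR_fact_lt_0 n) as Hf.
  rewrite (Rabs_right (/ INR (fact n))) by (apply Rle_ge, Rlt_le, Rinv_0_lt_compat, Hf).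
  replace (C * (/ INR (fact n) * (2 ^ n * Rabs x ^ n)))
    with (2 ^ n * C * / INR (fact n) * Rabs x ^ n) by ring.
  apply Rmult_le_compat_r; [apply pow_le, Rabs_pos|].
  apply Rmult_le_compat_r; [left; apply Rinv_0_lt_compat, Hf|].
  now apply neighbour_sum_bound.
Qed.

Lemma is_series_heat_majorant C x :
  is_series (fun n => C * (/ INR (fact n) * (2 * Rabs x) ^ n)) (C * exp (2 * Rabs x)).
Proof.
  apply (is_series_scal_l C (fun n => / INR (fact n) * (2 * Rabs x) ^ n)).
  apply is_pseries_R, is_exp_Reals.
Qed.

Lemma ex_series_heat C p j x : bounded_by C p ->
  ex_series (fun n => Rabs (heat_coef p j n * x ^ n)).
Proof.
  intros Hp.
  apply (ex_series_le (fun n => Rabs (heat_coef p j n * x ^ n) : R_CompleteNormedModule)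
           (fun n => C * (/ INR (fact n) * (2 * Rabs x) ^ n))).
  - intros n; change (Rabs (Rabs (heat_coef p j n * x ^ n)) <=
                      C * (/ INR (fact n) * (2 * Rabs x) ^ n)).
    rewrite Rabs_Rabsolu; now apply heat_coef_bound.
  - eexists; apply is_series_heat_majorant.
Qed.

(** At any radius [r] each term is at most the full sum [C exp(2 |r|)] of the majorants, so no
    finite radius is possible. *)
Lemma CV_radius_heat C p j : bounded_by C p -> CV_radius (heat_coef p j) = p_infty.
Proof.
  intros Hp.
  destruct (CV_radius_bounded (heat_coef p j)) as [Hub _].
  assert (H : forall r, Rbar_le (Finite r) (CV_radius (heat_coef p j))).
  { intros r; apply Hub; exists (C * exp (2 * Rabs r)); intros n.
    eapply Rle_trans; [now apply heat_coef_bound|].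
    set (f := fun n => C * (/ INR (fact n) * (2 * Rabs r) ^ n)).
    assert (Hf : forall n, 0 <= f n).
    { intros m; apply Rmult_le_pos.
      - eapply Rle_trans; [apply Rabs_pos | apply (Hp 0%Z)].
      - apply Rmult_le_pos; [left; apply Rinv_0_lt_compat, INR_fact_lt_0|].
        apply pow_le; pose proof (Rabs_pos r); lra. }
    apply Rle_trans with (sum_f_R0 f n); [|apply sum_incr; [|exact Hf]].
    - change (f n <= sum_f_R0 f n); destruct n as [|n]; [apply Rle_refl|].
      rewrite tech5; pose proof (cond_pos_sum f n Hf); lra.
    - apply is_series_Reals, is_series_heat_majorant. }
  destruct (CV_radius (heat_coef p j)) as [r| |]; auto.
  - specialize (H (r + 1)); simpl in H; lra.
  - destruct (H 0).
Qed.

(** The majorants sum to [C exp(2t)], which the prefactor cancels exactly: the discrete heat kernel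
    has mass one. *)
Lemma heat_bound C p t : bounded_by C p -> 0 <= t -> bounded_by C (heat p t).
Proof.
  intros Hp Ht j; unfold heat.
  rewrite Rabs_mult, (Rabs_right (exp _)) by (apply Rle_ge, Rlt_le, exp_pos).
  replace C with (exp (- (2 * t)) * (C * exp (2 * t)))
    by (rewrite Rmult_comm, Rmult_assoc, <- exp_plus, Rplus_opp_r, exp_0; ring).
  apply Rmult_le_compat_l; [left; apply exp_pos|].
  eapply Rle_trans; [apply Series_Rabs, ex_series_heat with C; exact Hp|].
  replace (2 * t) with (2 * Rabs t) by (rewrite Rabs_right; lra).
  rewrite <- (is_series_unique _ _ (is_series_heat_majorant C t)).
  apply Series_le; [|eexists; apply is_series_heat_majorant].
  intros n; split; [apply Rabs_pos | now apply heat_coef_bound].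
Qed.

Lemma heat_0 p j : heat p 0 j = p j.
Proof.
  unfold heat; rewrite PSeries_0, Rmult_0_r, Ropp_0, exp_0.
  unfold heat_coef; simpl; field.
Qed.

(** In coefficients, the identity that the derivative of [exp(tN)] is [N exp(tN)], with [N] the
    neighbour sum. *)
Lemma heat_coef_derive p j n :
  PS_derive (heat_coef p j) n =
  PS_plus (heat_coef p (j + 1)) (heat_coef p (j - 1)) n.
Proof.
  unfold PS_derive, PS_plus, heat_coef; simpl neighbour_sum.
  change (plus ?x ?y) with (x + y).
  rewrite fact_simpl, mult_INR; field; split; [apply INR_fact_neq_0|].
  apply not_0_INR; lia.
Qed.

Lemma heat_derive C p t j : bounded_by C p ->
  is_derive (fun s => heat p s j) t (Lap (heat p t) j).
Proof.
  intros Hp.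
  assert (HR : forall i, Rbar_lt (Rabs t) (CV_radius (heat_coef p i)))
    by (intros i; rewrite (CV_radius_heat C p i Hp); exact I).
  pose proof (is_derive_PSeries _ _ (HR j)) as HD.
  rewrite (PSeries_ext _ _ t (heat_coef_derive p j)) in HD.
  rewrite PSeries_plus in HD by (apply CV_radius_inside, HR).
  unfold heat; auto_derive; [eexists; apply HD|].
  change (fun x => PSeries (heat_coef p j) x) with (PSeries (heat_coef p j)).
  rewrite (is_derive_unique _ _ _ HD); unfold Lap; ring.
Qed.

(** [4 C] bounds [Lap] with its weights 1, 2, 1. It does not depend on [j], which is what continuity
    in the sup norm requires. *)
Lemma heat_lipschitz C p s t j : bounded_by C p -> 0 <= s -> 0 <= t ->
  Rabs (heat p s j - heat p t j) <= 4 * C * Rabs (s - t).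
Proof.
  intros Hp Hs Ht.
  destruct (MVT_gen (fun r => heat p r j) t s (fun r => Lap (heat p r) j)) as [c [Hc ->]].
  - intros r _; now apply heat_derive with C.
  - intros r _; apply continuity_pt_filterlim, (ex_derive_continuous (fun r => heat p r j)).
    eexists; now apply heat_derive with C.
  - rewrite Rabs_mult; apply Rmult_le_compat_r; [apply Rabs_pos|].
    assert (Hc0 : 0 <= c) by (unfold Rmin in Hc; destruct Rle_dec in Hc; lra).
    pose proof (heat_bound C p c Hp Hc0) as Hb; unfold Lap.
    pose proof (Hb j) as H1; pose proof (Hb (j + 1)%Z) as H2; pose proof (Hb (j - 1)%Z) as H3.
    revert H1 H2 H3; unfold Rabs; repeat destruct Rcase_abs; lra.
Qed.

(** * A single phase *)

(** Taken in [Rbar], so that the empty set, that is a phase lasting forever, yields [p_infty]. *)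
Definition crossing (f : R -> R) : Rbar := Glb_Rbar (fun s => 0 <= s /\ 0 <= f s).

Section Crossing.

Variable f : R -> R.
Hypothesis f_cont : forall t, continuous f t.
Hypothesis f_init : f 0 < 0.

Lemma crossing_lower (s : R) : 0 <= s -> Rbar_lt s (crossing f) -> f s < 0.
Proof.
  intros Hs Hlt; apply Rnot_le_lt; intros Hf.
  destruct (Glb_Rbar_correct (fun s => 0 <= s /\ 0 <= f s)) as [Hlb _].
  exact (Rbar_lt_not_le _ _ Hlt (Hlb s (conj Hs Hf))).
Qed.

Lemma locally_neg (t : R) : f t < 0 -> exists d, 0 < d /\ forall s, Rabs (s - t) < d -> f s < 0.
Proof.
  intros Ht.
  destruct (f_cont t (fun y => y < 0)) as [d Hd].
  - apply (open_lt 0); exact Ht.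
  - exists d; split; [apply cond_pos | intros s Hs; apply (Hd s Hs)].
Qed.

Lemma crossing_pos : Rbar_lt 0 (crossing f).
Proof.
  destruct (locally_neg 0 f_init) as [d [Hd0 Hd]].
  destruct (Glb_Rbar_correct (fun s => 0 <= s /\ 0 <= f s)) as [_ Hglb].
  apply Rbar_lt_le_trans with (Finite d); [exact Hd0|].
  apply Hglb; intros x [Hx1 Hx2]; simpl.
  apply Rnot_lt_le; intros Hx.
  enough (f x < 0) by lra; apply Hd; rewrite Rabs_right; lra.
Qed.

Lemma crossing_zero (h : R) : crossing f = Finite h -> f h = 0.
Proof.
  intros Hh.
  assert (Hpos : 0 < h) by (pose proof crossing_pos as H; rewrite Hh in H; exact H).
  destruct (Glb_Rbar_correct (fun s => 0 <= s /\ 0 <= f s)) as [Hlb Hglb].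
  fold (crossing f) in Hlb, Hglb; rewrite Hh in Hlb, Hglb.
  destruct (Rtotal_order (f h) 0) as [Hneg|[H0|Hgt]]; [exfalso| exact H0 | exfalso].
  - destruct (locally_neg h Hneg) as [d [Hd0 Hd]].
    enough (h + d <= h) by lra.
    apply (Hglb (Finite (h + d))); intros x [Hx1 Hx2]; simpl.
    apply Rnot_lt_le; intros Hx.
    assert (Hhx : h <= x) by (apply (Hlb x); split; assumption).
    enough (f x < 0) by lra; apply Hd; rewrite Rabs_right; lra.
  - destruct (f_cont h (fun y => 0 < y)) as [d Hd].
    { apply (open_gt 0); exact Hgt. }
    pose proof (cond_pos d).
    (* A point left of [h], nonnegative thanks to [h / 2] and still in the region [0 < f] thanks to
       [d / 2]; it contradicts that [h] is a lower bound. *)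
    set (x := h - Rmin (h / 2) (d / 2)).
    assert (Hm : 0 < Rmin (h / 2) (d / 2)) by (apply Rmin_pos; lra).
    pose proof (Rmin_l (h / 2) (d / 2)); pose proof (Rmin_r (h / 2) (d / 2)).
    assert (0 < f x).
    { apply Hd; change (Rabs (x - h) < d); unfold x.
      rewrite Rabs_left1; lra. }
    assert (h <= x) by (apply (Hlb x); split; [unfold x|]; lra).
    unfold x in *; lra.
Qed.

End Crossing.

(** Left difference quotients at [h] are nonnegative; tolerance [- l] in the derivative would make
    one negative if [l < 0]. *)
Lemma left_derive_nonneg (f : R -> R) (h l : R) : 0 < h ->
  is_derive f h l -> (forall s, 0 <= s < h -> f s <= f h) -> 0 <= l.
Proof.
  intros Hh Hd Hf; apply is_derive_Reals in Hd; apply Rnot_lt_le; intros Hl.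
  destruct (Hd (- l)) as [e He]; [lra|].
  pose proof (cond_pos e).
  set (m := Rmin (h / 2) (e / 2)).
  assert (Hm : 0 < m) by (apply Rmin_pos; lra).
  assert (m <= h / 2) by apply Rmin_l; assert (m <= e / 2) by apply Rmin_r.
  specialize (He (- m)).
  rewrite Rabs_Ropp, (Rabs_right m) in He by lra.
  assert (Hq : 0 <= (f (h + - m) - f h) / - m).
  { replace ((f (h + - m) - f h) / - m) with ((f h - f (h + - m)) / m) by (field; lra).
    apply Rmult_le_pos; [|left; apply Rinv_0_lt_compat; lra].
    enough (f (h + - m) <= f h) by lra; apply Hf; lra. }
  assert (He' := He ltac:(lra) ltac:(lra)).
  rewrite Rabs_right in He'; lra.
Qed.

Lemma is_derive_affine (f : R -> R) (a b c t l : R) :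
  is_derive f t l -> is_derive (fun s => a * f s + c + b * s) t (a * l + b).
Proof.
  intros H; auto_derive; [eexists; apply H|].
  change (fun x => f x) with f; rewrite (is_derive_unique _ _ _ H); ring.
Qed.

Definition phase_sgn (k j : Z) : R := if Z_lt_dec j k then 1 else -1.

Lemma phase_sgn_lt k j : (j < k)%Z -> phase_sgn k j = 1.
Proof. intros H; unfold phase_sgn; destruct Z_lt_dec; [reflexivity | lia]. Qed.

Lemma phase_sgn_ge k j : (k <= j)%Z -> phase_sgn k j = -1.
Proof. intros H; unfold phase_sgn; destruct Z_lt_dec; [lia | reflexivity]. Qed.

(** Inverts [dPhi] with the signs frozen to the pattern of [X k]. It is defined for all [s], but
    solves the nonlinear equation only while that pattern persists. *)
Definition phase (k : Z) (v : Z -> R) (s : R) (j : Z) : R :=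
  heat (fun i => dPhi (v i)) s j + phase_sgn k j.

(* Site k-1 is the one that has just crossed, so its value may vanish. *)
Definition admissible (D : R) (k : Z) (v : Z -> R) : Prop :=
  exists d, 0 < d /\
    (forall j, (j < k - 1)%Z -> d <= v j) /\
    0 <= v (k - 1)%Z /\
    (forall j, (k <= j)%Z -> -2 + d <= v j <= - d) /\
    (forall j, v j <= D).

(** The value 0 is allowed on the left only, in accordance with [sgn 0 = 1]. *)
Lemma dPhi_phase (k : Z) (x : R) (j : Z) :
  ((j < k)%Z -> 0 <= x) -> ((k <= j)%Z -> x < 0) -> dPhi x = x - phase_sgn k j.
Proof.
  intros H1 H2; unfold dPhi, sgn, phase_sgn.
  destruct (Rlt_dec x 0); destruct (Z_lt_dec j k) as [Hj|Hj]; try reflexivity.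
  - specialize (H1 Hj); lra.
  - specialize (H2 ltac:(lia)); lra.
Qed.

Section Phase.

Variables (D : R) (k : Z) (v : Z -> R) (d : R).
Hypothesis HD : 2 <= D.
Hypothesis Hd : 0 < d.
Hypothesis Hleft : forall j, (j < k - 1)%Z -> d <= v j.
Hypothesis Hlast : 0 <= v (k - 1)%Z.
Hypothesis Hright : forall j, (k <= j)%Z -> -2 + d <= v j <= - d.
Hypothesis Hupper : forall j, v j <= D.

Let p (j : Z) : R := dPhi (v j).

Lemma dPhi_left j : (j < k)%Z -> p j = v j - 1.
Proof.
  intros Hj; unfold p; rewrite (dPhi_phase k (v j) j), phase_sgn_lt; auto; intros Hj'.
  - destruct (Z.eq_dec j (k - 1)) as [->|]; [assumption|].
    specialize (Hleft j ltac:(lia)); lra.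
  - lia.
Qed.

Lemma dPhi_right j : (k <= j)%Z -> p j = v j + 1.
Proof.
  intros Hj; unfold p; rewrite (dPhi_phase k (v j) j).
  - rewrite phase_sgn_ge by assumption; ring.
  - lia.
  - specialize (Hright j Hj); lra.
Qed.

Lemma dPhi_ge j : -1 <= p j.
Proof.
  destruct (Z_lt_dec j k) as [Hj|Hj].
  - rewrite dPhi_left by assumption.
    destruct (Z.eq_dec j (k - 1)) as [->|]; [lra|].
    specialize (Hleft j ltac:(lia)); lra.
  - rewrite dPhi_right by lia; specialize (Hright j ltac:(lia)); lra.
Qed.

(** Site [k - 1] is excluded because it may sit at 0, where [p] equals -1; to the right of it the
    margin comes from [-2 + d <= v j]. *)
Lemma dPhi_ge_strict j : j <> (k - 1)%Z -> d <= p j + 1.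
Proof.
  intros Hk; destruct (Z_lt_dec j k) as [Hj|Hj].
  - rewrite dPhi_left by assumption; specialize (Hleft j ltac:(lia)); lra.
  - rewrite dPhi_right by lia; specialize (Hright j ltac:(lia)); lra.
Qed.

Lemma dPhi_le j : p j <= D - 1.
Proof.
  destruct (Z_lt_dec j k) as [Hj|Hj].
  - rewrite dPhi_left by assumption; specialize (Hupper j); lra.
  - rewrite dPhi_right by lia; specialize (Hright j ltac:(lia)); lra.
Qed.

Lemma dPhi_bounded : bounded_by D p.
Proof.
  intros j; apply Rabs_le; pose proof (dPhi_ge j); pose proof (dPhi_le j); lra.
Qed.

Lemma phase_0 j : phase k v 0 j = v j.
Proof.
  unfold phase; rewrite heat_0.
  destruct (Z_lt_dec j k) as [Hj|Hj].
  - fold (p j); rewrite dPhi_left, phase_sgn_lt by assumption; ring.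
  - fold (p j); rewrite dPhi_right, phase_sgn_ge by lia; ring.
Qed.

Lemma phase_derive j t : is_derive (fun s => phase k v s j) t (Lap (heat p t) j).
Proof.
  unfold phase; replace (Lap (heat p t) j) with (Lap (heat p t) j + 0) by ring.
  apply (is_derive_plus (fun s => heat p s j) (fun _ => phase_sgn k j)).
  - apply heat_derive with D, dPhi_bounded.
  - apply (is_derive_const (phase_sgn k j)).
Qed.

Lemma heat_affine_derive (a c : R) j t :
  is_derive (fun s => a * heat p s j + c) t (a * Lap (heat p t) j).
Proof.
  apply (is_derive_ext (fun s => a * heat p s j + c + 0 * s)); [intros s; apply Rminus_diag_uniq; ring|].
  replace (a * Lap (heat p t) j) with (a * Lap (heat p t) j + 0) by ring.
  apply is_derive_affine, heat_derive with D, dPhi_bounded.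
Qed.

(** Constants are stationary for [Lap], so [heat + 1] is a solution, nonnegative at time 0, and
    [comparison_decay] applies without boundary. The factor [1 *] only matches
    [heat_affine_derive]. *)
Lemma heat_lower j t : 0 <= t -> exp (- (2 * t)) * (p j + 1) <= heat p t j + 1.
Proof.
  intros Ht.
  pose proof (comparison_decay (fun _ => True) 0 t D
    (fun s i => 1 * heat p s i + 1) (fun s i => 1 * Lap (heat p s) i)) as H.
  replace t with (t - 0) at 1 by ring.
  rewrite <- (heat_0 p j), <- (Rmult_1_l (heat p 0 j)), <- (Rmult_1_l (heat p t j)).
  apply H; auto.
  - intros i _; apply continuous_on_of_derive with (df := fun s => 1 * Lap (heat p s) i).
    intros s; apply heat_affine_derive.
  - intros i s _ _; split; [apply heat_affine_derive|]; unfold Lap; lra.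
  - intros i s Hn; now destruct Hn.
  - intros i _; rewrite heat_0; pose proof (dPhi_ge i); lra.
  - intros i s Hs; pose proof (heat_bound D p s dPhi_bounded (proj1 Hs) i) as Hb.
    apply Rabs_le_between in Hb; lra.
  - unfold Icc; lra.
Qed.

Lemma heat_ge j t : 0 <= t -> -1 <= heat p t j.
Proof.
  intros Ht; pose proof (heat_lower j t Ht); pose proof (dPhi_ge j).
  pose proof (exp_pos (- (2 * t))); nra.
Qed.

Lemma heat_le j t : 0 <= t -> heat p t j <= D - 1.
Proof.
  intros Ht.
  enough (0 <= -1 * heat p t j + (D - 1)) by lra.
  apply (comparison_nonneg (fun _ => True) 0 t (D + D)
    (fun s i => -1 * heat p s i + (D - 1)) (fun s i => -1 * Lap (heat p s) i)).
  - intros i _; apply continuous_on_of_derive with (df := fun s => -1 * Lap (heat p s) i).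
    intros s; apply heat_affine_derive.
  - intros i s _ _; split; [apply heat_affine_derive|]; unfold Lap; lra.
  - intros i s Hn; now destruct Hn.
  - intros i _; rewrite heat_0; pose proof (dPhi_le i); lra.
  - intros i s Hs; pose proof (heat_bound D p s dPhi_bounded (proj1 Hs) i) as Hb.
    apply Rabs_le_between in Hb; lra.
  - unfold Icc; lra.
Qed.

(** Strong minimum principle at the one site without margin: both its neighbours exceed -1 by a
    definite amount and lift it off, at least as fast as a line of slope [c]. *)
Lemma heat_last_gt t : 0 < t -> -1 < heat p t (k - 1).
Proof.
  intros Ht.
  set (e := exp (- (2 * t))); assert (He : 0 < e) by apply exp_pos.
  (* On [[0, t]] the two neighbours contribute at least [2 d e], while subtracting [c s] costs
     [c (1 + 2 s)]; this [c] balances the two at [s = t]. *)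
  set (c := 2 * d * e / (1 + 2 * t)).
  assert (Hc : 0 < c) by (apply Rdiv_lt_0_compat; nra).
  assert (Hce : c * (1 + 2 * t) = 2 * d * e) by (unfold c; field; lra).
  assert (Hder : forall s, is_derive (fun s => heat p s (k - 1) + 1 - c * s) s
                     (Lap (heat p s) (k - 1) - c)).
  { intros s.
    apply (is_derive_ext (fun s => 1 * heat p s (k - 1) + 1 + - c * s)); [intros r; apply Rminus_diag_uniq; ring|].
    replace (Lap (heat p s) (k - 1) - c) with (1 * Lap (heat p s) (k - 1) + - c) by ring.
    apply is_derive_affine, heat_derive with D, dPhi_bounded. }
  assert (H : exp (- (2 * (t - 0))) * (heat p 0 (k - 1) + 1 - c * 0)
              <= heat p t (k - 1) + 1 - c * t).
  { apply (exp_weight_le (fun s => heat p s (k - 1) + 1 - c * s)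
             (fun s => Lap (heat p s) (k - 1) - c)); [lra| |].
    - eapply continuous_on_of_derive; apply Hder.
    - intros s Hs; split; [apply Hder|].
      assert (Hes : e <= exp (- (2 * s))) by (left; apply exp_increasing; lra).
      pose proof (heat_lower k s ltac:(lra)) as H1.
      pose proof (heat_lower (k - 1 - 1) s ltac:(lra)) as H2.
      pose proof (dPhi_ge_strict k ltac:(lia)) as H3.
      pose proof (dPhi_ge_strict (k - 1 - 1) ltac:(lia)) as H4.
      unfold Lap; replace (k - 1 + 1)%Z with k by lia.
      assert (d * e <= exp (- (2 * s)) * (p k + 1)) by nra.
      assert (d * e <= exp (- (2 * s)) * (p (k - 1 - 1)%Z + 1)) by nra.
      nra. }
  rewrite heat_0 in H; pose proof (dPhi_ge (k - 1)).
  pose proof (exp_pos (- (2 * (t - 0)))).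
  assert (0 <= exp (- (2 * (t - 0))) * (p (k - 1)%Z + 1 - c * 0))
    by (apply Rmult_le_pos; lra).
  nra.
Qed.

Lemma heat_right h j t : (forall s, 0 <= s <= h -> phase k v s k <= 0) ->
  0 <= t <= h -> (k < j)%Z -> exp (- (2 * t)) * (1 - p j) <= 1 - heat p t j.
Proof.
  intros Hk Ht Hj.
  (* Comparison for [1 - heat] on the half-line right of [k]. Left of [k] this quantity may be
     negative, so it is replaced by 0 there; its true value at [k] is kept, since [Lap] at [k + 1]
     sees it and [Hk] makes it nonnegative. *)
  pose proof (comparison_decay (fun j => (k < j)%Z) 0 t (D + 1)
    (fun s i => if Z_lt_dec i k then 0 else -1 * heat p s i + 1)
    (fun s i => -1 * Lap (heat p s) i)) as H.
  specialize (fun H1 H2 H3 H4 H5 => H H1 H2 H3 H4 H5 j t Hj).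
  cbv beta in H; destruct (Z_lt_dec j k); [lia|].
  rewrite heat_0, Rminus_0_r in H.
  replace (1 - p j) with (-1 * p j + 1) by ring.
  replace (1 - heat p t j) with (-1 * heat p t j + 1) by ring.
  apply H; clear H.
  - intros i Hi; destruct (Z_lt_dec i k); [lia|].
    apply continuous_on_of_derive with (df := fun s => -1 * Lap (heat p s) i).
    intros s; apply heat_affine_derive.
  - intros i s Hi _; destruct (Z_lt_dec i k); [lia|].
    split; [apply heat_affine_derive|]; unfold Lap.
    destruct (Z_lt_dec (i + 1) k); [lia|]; destruct (Z_lt_dec (i - 1) k); [lia|].
    destruct (Z_lt_dec i k); [lia|]; lra.
  - intros i s Hi Hs; destruct (Z_lt_dec i k); [lra|].
    replace i with k by lia.
    unfold Icc in Hs; specialize (Hk s ltac:(lra)); unfold phase in Hk.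
    rewrite phase_sgn_ge in Hk by lia; fold p in Hk; lra.
  - intros i Hi; destruct (Z_lt_dec i k); [lia|]; rewrite heat_0.
    rewrite dPhi_right by lia; specialize (Hright i ltac:(lia)); lra.
  - intros i s Hs; destruct (Z_lt_dec i k); [lra|].
    pose proof (heat_bound D p s dPhi_bounded (proj1 Hs) i) as Hb.
    apply Rabs_le_between in Hb; lra.
  - unfold Icc; lra.
Qed.

Lemma phase_le h s j : (forall s, 0 <= s <= h -> phase k v s k <= 0) ->
  0 <= s <= h -> phase k v s j <= D.
Proof.
  intros Hk Hs; destruct (Z_lt_dec j k) as [Hj|Hj].
  - unfold phase; rewrite phase_sgn_lt by assumption.
    pose proof (heat_le j s (proj1 Hs)) as H; unfold p in H; lra.
  - destruct (Z.eq_dec j k) as [->|Hn]; [specialize (Hk s Hs); lra|].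
    unfold phase; rewrite phase_sgn_ge by lia.
    pose proof (heat_le j s (proj1 Hs)) as H; unfold p in H; lra.
Qed.

Lemma phase_left j s : (j < k - 1)%Z -> 0 <= s -> d * exp (- (2 * s)) <= phase k v s j.
Proof.
  intros Hj Hs; unfold phase; rewrite phase_sgn_lt by lia; fold p.
  pose proof (heat_lower j s Hs); pose proof (dPhi_ge_strict j ltac:(lia)).
  pose proof (exp_pos (- (2 * s))); nra.
Qed.

Lemma phase_last s : 0 <= s -> 0 <= phase k v s (k - 1).
Proof.
  intros Hs; unfold phase; rewrite phase_sgn_lt by lia; fold p.
  pose proof (heat_ge (k - 1) s Hs); lra.
Qed.

Lemma phase_last_pos s : 0 < s -> 0 < phase k v s (k - 1).
Proof.
  intros Hs; unfold phase; rewrite phase_sgn_lt by lia; fold p.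
  pose proof (heat_last_gt s Hs); lra.
Qed.

Lemma phase_right_ge j s : (k <= j)%Z -> 0 <= s -> -2 + d * exp (- (2 * s)) <= phase k v s j.
Proof.
  intros Hj Hs; unfold phase; rewrite phase_sgn_ge by lia; fold p.
  pose proof (heat_lower j s Hs); pose proof (dPhi_ge_strict j ltac:(lia)).
  pose proof (exp_pos (- (2 * s))); nra.
Qed.

Lemma phase_right_le h j s : (forall s, 0 <= s <= h -> phase k v s k <= 0) ->
  0 <= s <= h -> (k < j)%Z -> phase k v s j <= - (d * exp (- (2 * s))).
Proof.
  intros Hk Hs Hj; unfold phase; rewrite phase_sgn_ge by lia; fold p.
  pose proof (heat_right h j s Hk Hs Hj) as H.
  rewrite dPhi_right in H by lia; specialize (Hright j ltac:(lia)).
  pose proof (exp_pos (- (2 * s))); nra.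
Qed.

Lemma phase_dPhi s j : (forall r, 0 <= r <= s -> phase k v r k < 0) -> 0 <= s ->
  dPhi (phase k v s j) = heat p s j.
Proof.
  intros Hk Hs; rewrite (dPhi_phase k _ j).
  - unfold phase; fold p; ring.
  - intros Hj; destruct (Z.eq_dec j (k - 1)) as [->|Hn]; [now apply phase_last|].
    pose proof (phase_left j s ltac:(lia) Hs); pose proof (exp_pos (- (2 * s))); nra.
  - intros Hj; destruct (Z.eq_dec j k) as [->|Hn]; [apply Hk; lra|].
    assert (Hk' : forall r, 0 <= r <= s -> phase k v r k <= 0) by (intros r Hr; left; auto).
    pose proof (phase_right_le s j s Hk' ltac:(lra) ltac:(lia)).
    pose proof (exp_pos (- (2 * s))); nra.
Qed.

(** Only sites [k - 1] and [k] escape the uniform margin [d exp(-2s)]. Each is a single site, so the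
    minimum with their distances to 0 is still positive; for [k - 1] this needs [0 < s]. *)
Lemma phase_separated s : (forall r, 0 <= r <= s -> phase k v r k < 0) -> 0 < s ->
  exists e, 0 < e /\ (forall j, (j < k)%Z -> e <= phase k v s j <= D) /\
    (forall j, (k <= j)%Z -> -2 + e <= phase k v s j <= - e).
Proof.
  intros Hk Hs.
  assert (Hk' : forall r, 0 <= r <= s -> phase k v r k <= 0) by (intros r Hr; left; auto).
  set (e := d * exp (- (2 * s))).
  assert (He : 0 < e) by (apply Rmult_lt_0_compat; [assumption | apply exp_pos]).
  pose proof (phase_last_pos s Hs) as Hl; specialize (Hk s ltac:(lra)).
  set (m := Rmin e (Rmin (phase k v s (k - 1)) (- phase k v s k))).
  assert (Hm : 0 < m) by (unfold m; repeat apply Rmin_pos; lra).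
  assert (m <= e) by apply Rmin_l.
  assert (Hm2 : m <= Rmin (phase k v s (k - 1)) (- phase k v s k)) by apply Rmin_r.
  pose proof (Rmin_l (phase k v s (k - 1)) (- phase k v s k)).
  pose proof (Rmin_r (phase k v s (k - 1)) (- phase k v s k)).
  exists m; split; [assumption|split; intros j Hj; split].
  - destruct (Z.eq_dec j (k - 1)) as [->|Hn]; [lra|].
    pose proof (phase_left j s ltac:(lia) ltac:(lra)); unfold e in *; lra.
  - apply (phase_le s s j Hk'); lra.
  - pose proof (phase_right_ge j s Hj ltac:(lra)); unfold e in *; lra.
  - destruct (Z.eq_dec j k) as [->|Hn]; [lra|].
    pose proof (phase_right_le s j s Hk' ltac:(lra) ltac:(lia)); unfold e in *; lra.
Qed.

(** * The transition that ends a phase *)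

Section Hit.

Variable h : R.
Hypothesis Hh : 0 < h.
Hypothesis before : forall s, 0 <= s < h -> phase k v s k < 0.
Hypothesis zero : phase k v h k = 0.

Lemma before_le s : 0 <= s <= h -> phase k v s k <= 0.
Proof.
  intros Hs; destruct (Req_dec s h) as [->|]; [lra | left; apply before; lra].
Qed.

Lemma hit_velocity : 0 <= Lap (heat p h) k.
Proof.
  apply (left_derive_nonneg (fun s => phase k v s k) h); [assumption| |].
  - apply phase_derive.
  - intros s Hs; rewrite zero; left; auto.
Qed.

Lemma hit_heat : heat p h k = 1.
Proof.
  pose proof zero as H; unfold phase in H.
  rewrite phase_sgn_ge in H by lia; fold p in H; lra.
Qed.

Lemma hit_left : 2 < phase k v h (k - 1).
Proof.
  pose proof hit_velocity as H; unfold Lap in H; rewrite hit_heat in H.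
  pose proof (phase_right_le h (k + 1) h before_le ltac:(lra) ltac:(lia)) as H1.
  assert (0 < d * exp (- (2 * h))) by (apply Rmult_lt_0_compat; [assumption | apply exp_pos]).
  unfold phase in *; rewrite phase_sgn_ge in H1 by lia; rewrite phase_sgn_lt by lia.
  fold p in H1 |- *; lra.
Qed.

(** Closes the induction over phases: site [k], now at 0, takes the role that [k - 1] had. *)
Lemma hit_admissible : admissible D (k + 1) (phase k v h).
Proof.
  set (e := d * exp (- (2 * h))).
  assert (He : 0 < e) by (apply Rmult_lt_0_compat; [assumption | apply exp_pos]).
  pose proof hit_left.
  (* Site [k - 1] need not satisfy the margin [e], but it exceeds 2, so a margin of at most 1 suits
     it. *)
  exists (Rmin e 1); replace (k + 1 - 1)%Z with k by lia.
  pose proof (Rmin_l e 1); pose proof (Rmin_r e 1).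
  repeat split.
  - apply Rmin_pos; lra.
  - intros j Hj; destruct (Z.eq_dec j (k - 1)) as [->|Hn]; [lra|].
    pose proof (phase_left j h ltac:(lia) ltac:(lra)); unfold e in *; lra.
  - rewrite zero; lra.
  - pose proof (phase_right_ge j h ltac:(lia) ltac:(lra)); unfold e in *; lra.
  - pose proof (phase_right_le h j h before_le ltac:(lra) ltac:(lia)); unfold e in *; lra.
  - intros j; apply (phase_le h h j before_le); lra.
Qed.

(** Since [sgn 0 = 1], [dPhi] of the state differs from [heat] at site [k] by -2, which [Lap] weighs
    by -2; at the two neighbours they agree. *)
Lemma hit_rhs : rhs (phase k v h) k = 4 + Lap (heat p h) k.
Proof.
  unfold rhs, Lap.
  destruct hit_admissible as [e [He [_ [_ [Hr _]]]]].
  rewrite zero, hit_heat.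
  rewrite (dPhi_phase k (phase k v h (k + 1)) (k + 1)).
  2: lia. 2: intros _; specialize (Hr (k + 1)%Z ltac:(lia)); lra.
  rewrite (dPhi_phase k (phase k v h (k - 1)) (k - 1)).
  2: intros _; pose proof hit_left; lra. 2: lia.
  unfold dPhi at 1, sgn; destruct Rlt_dec; [lra|].
  unfold phase; fold p; ring.
Qed.

Lemma hit_rhs_ge : 4 <= rhs (phase k v h) k.
Proof. rewrite hit_rhs; pose proof hit_velocity; lra. Qed.

(* While p_k <= 1, the site k-1 satisfies p' <= 1 + (D-1) - 2p, and it has to
   climb from -1 to more than 1 before site k can cross. *)
Lemma hit_wait : v (k - 1)%Z = 0 -> 2 < D /\ ln (sqrt ((D + 2) / (D - 2))) <= h.
Proof.
  intros Hv.
  assert (Hder : forall s, is_derive (fun s => -1 * heat p s (k - 1) + D / 2) s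
                             (-1 * Lap (heat p s) (k - 1))).
  { intros s; apply heat_affine_derive. }
  assert (H : exp (- (2 * (h - 0))) * (-1 * heat p 0 (k - 1) + D / 2)
              <= -1 * heat p h (k - 1) + D / 2).
  { apply (exp_weight_le (fun s => -1 * heat p s (k - 1) + D / 2)
             (fun s => -1 * Lap (heat p s) (k - 1))); [lra| |].
    - eapply continuous_on_of_derive; apply Hder.
    - intros s Hs; split; [apply Hder|].
      pose proof (heat_le (k - 1 - 1) s ltac:(lra)).
      pose proof (before s ltac:(lra)) as Hb; unfold phase in Hb.
      rewrite phase_sgn_ge in Hb by lia; fold p in Hb.
      unfold Lap; replace (k - 1 + 1)%Z with k by lia; lra. }
  rewrite heat_0, dPhi_left, Hv, Rminus_0_r in H by lia.
  pose proof hit_left as Hl; unfold phase in Hl.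
  rewrite phase_sgn_lt in Hl by lia; fold p in Hl.
  pose proof (exp_pos (- (2 * h))) as He.
  (* [H] and [Hl] together say [exp(-2h) (D + 2) < D - 2]. Positivity of the left side gives
     [2 < D], and logarithms give the bound on [h]. *)
  assert (HD2 : 2 < D) by nra.
  split; [assumption|].
  assert (Hq : 0 < (D + 2) / (D - 2)) by (apply Rdiv_lt_0_compat; lra).
  rewrite <- (ln_exp h); apply ln_le; [now apply sqrt_lt_R0|].
  rewrite <- (sqrt_square (exp h)) by (left; apply exp_pos).
  apply sqrt_le_1_alt; rewrite <- exp_plus.
  replace (h + h) with (2 * h) by ring.
  apply Rmult_le_reg_r with (exp (- (2 * h)) * (D - 2)); [nra|].
  replace ((D + 2) / (D - 2) * (exp (- (2 * h)) * (D - 2)))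
    with (exp (- (2 * h)) * (D + 2)) by (field; lra).
  rewrite <- Rmult_assoc, <- exp_plus, Rplus_opp_r, exp_0; nra.
Qed.

End Hit.

End Phase.

(** * Bounded sequences and phase spaces *)

Lemma sup_on_ub (P : Z -> Prop) (v : Z -> R) j : P j -> Rbar_le (v j) (sup_on P v).
Proof.
  intros Hj; destruct (Lub_Rbar_correct (fun x => exists j, P j /\ x = v j)) as [H _].
  apply H; eauto.
Qed.

Lemma sup_on_le (P : Z -> Prop) (v : Z -> R) (b : Rbar) :
  (forall j, P j -> Rbar_le (v j) b) -> Rbar_le (sup_on P v) b.
Proof.
  intros Hb; destruct (Lub_Rbar_correct (fun x => exists j, P j /\ x = v j)) as [_ H].
  apply H; intros x [j [Hj ->]]; auto.
Qed.

Lemma inf_on_lb (P : Z -> Prop) (v : Z -> R) j : P j -> Rbar_le (inf_on P v) (v j).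
Proof.
  intros Hj; destruct (Glb_Rbar_correct (fun x => exists j, P j /\ x = v j)) as [H _].
  apply H; eauto.
Qed.

Lemma inf_on_ge (P : Z -> Prop) (v : Z -> R) (b : Rbar) :
  (forall j, P j -> Rbar_le b (v j)) -> Rbar_le b (inf_on P v).
Proof.
  intros Hb; destruct (Glb_Rbar_correct (fun x => exists j, P j /\ x = v j)) as [_ H].
  apply H; intros x [j [Hj ->]]; auto.
Qed.

Lemma bounded_by_norm v : in_linf v -> bounded_by (real (linf_norm v)) v.
Proof.
  intros Hv j; unfold in_linf in Hv.
  pose proof (sup_on_ub (fun _ => True) (fun j => Rabs (v j)) j I) as H.
  fold (sup_all (fun j => Rabs (v j))) in H; fold (linf_norm v) in H.
  destruct (linf_norm v); easy.
Qed.

Lemma linf_norm_le v (C : R) : bounded_by C v -> Rbar_le (linf_norm v) C.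
Proof. intros H; apply sup_on_le; intros j _; apply H. Qed.

Lemma bounded_by_in_linf v C : bounded_by C v -> in_linf v.
Proof.
  intros H; apply Rbar_le_lt_trans with (Finite C); [now apply linf_norm_le | exact I].
Qed.

Lemma linf_norm_lt v (C : R) : Rbar_lt (linf_norm v) C -> bounded_by C v.
Proof.
  intros Hv j.
  pose proof (bounded_by_norm v (Rbar_lt_trans _ _ p_infty Hv I) j) as H.
  pose proof (sup_on_ub (fun _ => True) (fun j => Rabs (v j)) j I) as H'.
  fold (sup_all (fun j => Rabs (v j))) in H'; fold (linf_norm v) in H'.
  destruct (linf_norm v); simpl in *; try easy; lra.
Qed.

Lemma real_norm_le v (C : R) : bounded_by C v -> real (linf_norm v) <= C.
Proof.
  intros H; pose proof (linf_norm_le v C H) as H1.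
  pose proof (bounded_by_norm v (bounded_by_in_linf v C H) 0%Z) as H2.
  pose proof (Rabs_pos (v 0%Z)); pose proof (H 0%Z).
  destruct (linf_norm v); simpl in *; try easy; lra.
Qed.

Lemma X_intro k v e C : 0 < e ->
  (forall j, (j < k)%Z -> e <= v j <= C) ->
  (forall j, (k <= j)%Z -> -2 + e <= v j <= - e) -> X k v.
Proof.
  intros He Hl Hr; split; [|split; [split; [|split]|split; [|split]]].
  - apply bounded_by_in_linf with (Rmax C 2); intros j; apply Rabs_le.
    pose proof (Rmax_l C 2); pose proof (Rmax_r C 2).
    destruct (Z_lt_dec j k) as [Hj|Hj].
    + specialize (Hl j Hj); lra.
    + specialize (Hr j ltac:(lia)); lra.
  - apply Rbar_lt_le_trans with (Finite e); [exact He|].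
    apply inf_on_ge; intros j Hj; apply (Hl j Hj).
  - apply Rbar_le_trans with (v (k - 1)%Z); [apply inf_on_lb | apply (sup_on_ub (fun j => (j < k)%Z))]; lia.
  - apply Rbar_le_lt_trans with (Finite C); [|exact I].
    apply sup_on_le; intros j Hj; apply (Hl j Hj).
  - apply Rbar_lt_le_trans with (Finite (-2 + e)); [simpl; lra|].
    apply inf_on_ge; intros j Hj; apply (Hr j Hj).
  - apply Rbar_le_trans with (v k); [apply inf_on_lb | apply (sup_on_ub (fun j => (k <= j)%Z))]; lia.
  - apply Rbar_le_lt_trans with (Finite (- e)); [|simpl; lra].
    apply sup_on_le; intros j Hj; apply (Hr j Hj).
Qed.

Lemma inf_on_gt (P : Z -> Prop) (v : Z -> R) (a : R) : Rbar_lt a (inf_on P v) ->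
  exists e, 0 < e /\ forall j, P j -> a + e <= v j.
Proof.
  intros H; pose proof (inf_on_lb P v) as Hlb.
  destruct (inf_on P v) as [b| |]; simpl in H; try easy.
  - exists (b - a); split; [lra|]; intros j Hj; specialize (Hlb j Hj); simpl in Hlb; lra.
  - exists 1; split; [lra|]; intros j Hj; destruct (Hlb j Hj).
Qed.

Lemma sup_on_lt (P : Z -> Prop) (v : Z -> R) (a : R) : Rbar_lt (sup_on P v) a ->
  exists e, 0 < e /\ forall j, P j -> v j <= a - e.
Proof.
  intros H; pose proof (sup_on_ub P v) as Hub.
  destruct (sup_on P v) as [b| |]; simpl in H; try easy.
  - exists (a - b); split; [lra|]; intros j Hj; specialize (Hub j Hj); simpl in Hub; lra.
  - exists 1; split; [lra|]; intros j Hj; destruct (Hub j Hj).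
Qed.

Lemma X_elim k v : X k v -> exists e, 0 < e /\
  (forall j, (j < k)%Z -> e <= v j) /\
  (forall j, (k <= j)%Z -> -2 + e <= v j <= - e).
Proof.
  intros [_ [[H1 _] [H2 [_ H3]]]].
  destruct (inf_on_gt _ _ _ H1) as [e1 [He1 H1']].
  destruct (inf_on_gt _ _ _ H2) as [e2 [He2 H2']].
  destruct (sup_on_lt _ _ _ H3) as [e3 [He3 H3']].
  exists (Rmin e1 (Rmin e2 e3)).
  pose proof (Rmin_l e1 (Rmin e2 e3)); pose proof (Rmin_r e1 (Rmin e2 e3)).
  pose proof (Rmin_l e2 e3); pose proof (Rmin_r e2 e3).
  split; [repeat apply Rmin_pos; assumption|split; intros j Hj].
  - specialize (H1' j Hj); lra.
  - specialize (H2' j Hj); specialize (H3' j Hj); lra.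
Qed.

Lemma X_admissible k v : X k v -> admissible (upper v) k v.
Proof.
  intros HX; destruct (X_elim k v HX) as [e [He [Hl Hr]]].
  exists e; split; [exact He|split; [|split; [|split]]].
  - intros j Hj; apply Hl; lia.
  - left; apply Rlt_le_trans with e; [exact He | apply Hl; lia].
  - exact Hr.
  - intros j; apply Rle_trans with (2 := Rmax_r _ _).
    destruct HX as [Hin _].
    (* Finiteness of the supremum, without which [real] inside [upper] would return a default
       value. *)
    assert (Hs : Rbar_le (sup_all v) (real (linf_norm v))).
    { apply sup_on_le; intros i _; apply Rle_trans with (1 := Rle_abs _).
      now apply bounded_by_norm. }
    pose proof (sup_on_ub (fun _ => True) v j I) as Hj; fold (sup_all v) in Hj.
    destruct (sup_all v); easy.
Qed.

Lemma X_neg k v j : X k v -> (k <= j)%Z -> v j < 0.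
Proof.
  intros HX Hj; destruct (X_elim k v HX) as [e [He [_ Hr]]].
  specialize (Hr j Hj); lra.
Qed.

(** Passes from an explicit [g], differentiable on both sides, to an [f] whose values at negative
    times are arbitrary. *)
Lemma deriv_at_intro (f g : R -> R) (t l : R) : 0 <= t -> is_derive g t l ->
  locally t (fun s => 0 <= s -> f s = g s) -> deriv_at f t l.
Proof.
  intros Ht Hg [d Hd]; apply is_derive_Reals in Hg.
  apply filterlim_locally; intros eps.
  destruct (Hg eps (cond_pos eps)) as [d' Hd'].
  assert (Hm : 0 < Rmin d d') by (apply Rmin_pos; apply cond_pos).
  exists (mkposreal _ Hm); intros s Hs Hne H0; simpl in Hs.
  change (Rabs (s - t) < Rmin d d') in Hs.
  pose proof (Rmin_l d d'); pose proof (Rmin_r d d').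
  rewrite (Hd s) by (try assumption; change (Rabs (s - t) < d); lra).
  rewrite (Hd t) by (try assumption; apply ball_center).
  specialize (Hd' (s - t)); replace (t + (s - t)) with s in Hd' by (apply Rminus_diag_uniq; ring).
  apply Hd'; [intros H'; apply Hne; lra | lra].
Qed.

Lemma deriv_at_elim (f : R -> R) (t l : R) : 0 < t -> deriv_at f t l -> is_derive f t l.
Proof.
  intros Ht H; apply is_derive_Reals; intros eps Heps.
  destruct (proj1 (filterlim_locally _ _) H (mkposreal eps Heps)) as [d Hd].
  assert (Hm : 0 < Rmin d t) by (apply Rmin_pos; [apply cond_pos | assumption]).
  exists (mkposreal _ Hm); intros s Hs Hs'; simpl in Hs'.
  pose proof (Rmin_l d t); pose proof (Rmin_r d t).
  specialize (Hd (t + s)); replace (t + s - t) with s in Hd by ring.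
  apply Hd.
  - change (Rabs (t + s - t) < d); replace (t + s - t) with s by ring; lra.
  - lra.
  - assert (Hs2 : Rabs s < t) by lra; apply Rabs_lt_between in Hs2; lra.
Qed.

Lemma linf_locally (u : R -> Z -> R) t : continuous_linf u -> 0 <= t -> forall e, 0 < e ->
  exists d, 0 < d /\ forall s, 0 <= s -> Rabs (s - t) < d -> forall j, Rabs (u s j - u t j) <= e.
Proof.
  intros [_ Hc] Ht e He; destruct (Hc t Ht (mkposreal e He)) as [d Hd].
  exists d; split; [apply cond_pos|]; intros s Hs Hst j.
  now apply (linf_norm_lt (fun j => u s j - u t j)), Hd.
Qed.

Lemma linf_continuous_on (u : R -> Z -> R) a b j : continuous_linf u -> 0 <= a ->
  continuous_on (Icc a b) (fun s => u s j).
Proof.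
  intros Hu Ha t Ht; apply filterlim_locally; intros eps.
  destruct (linf_locally u t Hu ltac:(unfold Icc in Ht; lra) (eps / 2)) as [d [Hd0 Hd]].
  { pose proof (cond_pos eps); lra. }
  exists (mkposreal d Hd0); intros s Hs Hs'; change (Rabs (u s j - u t j) < eps).
  specialize (Hd s ltac:(unfold Icc in Hs'; lra) Hs j); pose proof (cond_pos eps); lra.
Qed.

(** The sup norm is continuous in time and the interval compact. This supplies [bound_q] when the
    comparison is applied to an arbitrary solution. *)
Lemma linf_bounded_Icc (u : R -> Z -> R) a b : continuous_linf u -> 0 <= a -> a <= b ->
  exists C, forall t, Icc a b t -> bounded_by C (u t).
Proof.
  intros Hu Ha Hab.
  destruct (continuity_ab_maj (fun t => real (linf_norm (u (clamp a b t)))) a b Hab)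
    as [M [HM _]].
  - intros c _; apply continuity_pt_filterlim.
    apply (continuous_clamp (fun t => real (linf_norm (u t)))); [assumption|].
    intros t Ht; apply filterlim_locally; intros eps.
    assert (Ht0 : 0 <= t) by (unfold Icc in Ht; lra).
    pose proof (cond_pos eps) as Heps.
    destruct (linf_locally u t Hu Ht0 (eps / 2)) as [d [Hd0 Hd]]; [lra|].
    exists (mkposreal d Hd0); intros s Hs Hs'.
    assert (Hs0 : 0 <= s) by (unfold Icc in Hs'; lra).
    specialize (Hd s Hs0 Hs).
    pose proof (bounded_by_norm _ (proj1 Hu s Hs0)) as Bs.
    pose proof (bounded_by_norm _ (proj1 Hu t Ht0)) as Bt.
    change (Rabs (real (linf_norm (u s)) - real (linf_norm (u t))) < eps).
    assert (real (linf_norm (u s)) <= real (linf_norm (u t)) + eps / 2).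
    { apply real_norm_le; intros j; specialize (Hd j); specialize (Bt j).
      replace (u s j) with (u t j + (u s j - u t j)) by ring.
      eapply Rle_trans; [apply Rabs_triang | lra]. }
    assert (real (linf_norm (u t)) <= real (linf_norm (u s)) + eps / 2).
    { apply real_norm_le; intros j; specialize (Hd j); specialize (Bs j).
      replace (u t j) with (u s j + - (u s j - u t j)) by ring.
      eapply Rle_trans; [apply Rabs_triang | rewrite Rabs_Ropp; lra]. }
    apply Rabs_lt_between'; lra.
  - exists (real (linf_norm (u (clamp a b M)))); intros t Ht j.
    specialize (HM t Ht); rewrite (clamp_id a b t Ht) in HM.
    apply Rle_trans with (2 := HM), bounded_by_norm, (proj1 Hu).
    unfold Icc in Ht; lra.
Qed.

Lemma continuous_linf_lipschitz (u : R -> Z -> R) (C K : R) :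
  (forall t, 0 <= t -> bounded_by C (u t)) ->
  (forall s t j, 0 <= s -> 0 <= t -> Rabs (u s j - u t j) <= K * Rabs (s - t)) ->
  continuous_linf u.
Proof.
  intros HC HK; split; [intros t Ht; now apply bounded_by_in_linf with C, HC|].
  intros t Ht eps.
  assert (HK1 : 0 < Rabs K + 1) by (pose proof (Rabs_pos K); lra).
  assert (Hd : 0 < eps / 2 / (Rabs K + 1)).
  { apply Rdiv_lt_0_compat; [pose proof (cond_pos eps); lra | assumption]. }
  exists (mkposreal _ Hd); intros s Hs Hs0.
  change (Rabs (s - t) < eps / 2 / (Rabs K + 1)) in Hs.
  apply Rbar_le_lt_trans with (Finite (eps / 2)).
  - apply linf_norm_le; intros j; apply Rle_trans with (1 := HK s t j Hs0 Ht).
    apply (Rmult_lt_compat_l (Rabs K + 1)) in Hs; [|assumption].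
    replace ((Rabs K + 1) * (eps / 2 / (Rabs K + 1))) with (eps / 2) in Hs by (field; lra).
    pose proof (Rabs_pos (s - t)); pose proof (Rle_abs K); nra.
  - simpl; pose proof (cond_pos eps); lra.
Qed.

(** * Gluing the phases *)

Section Stages.

Variables (D : R) (k1 : Z) (u0 : Z -> R).
Hypothesis HD : 2 <= D.
Hypothesis Hadm : admissible D k1 u0.

Definition index (n : nat) : Z := (k1 + Z.of_nat n)%Z.

(* [stage n = Some (tau, v)] when phase n is reached, starting at time tau
   from the state v; [None] when some earlier phase lasts forever. *)
Fixpoint stage (n : nat) : option (R * (Z -> R)) :=
  match n with
  | O => Some (0, u0)
  | S m =>
    match stage m with
    | Some (tau, v) =>
      match crossing (fun s => phase (index m) v s (index m)) with
      | Finite h => Some (tau + h, phase (index m) v h)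
      | _ => None
      end
    | None => None
    end
  end.

(** [p_infty] both when phase [n] lasts forever and when it is never reached, as the first clause
    for transition times permits. *)
Definition end_time (n : nat) : Rbar :=
  match stage (S n) with Some (tau, _) => Finite tau | None => p_infty end.

Definition times (k : Z) : Rbar := end_time (Z.to_nat (k - k1)).

Lemma times_index n : times (index n) = end_time n.
Proof. unfold times, index; f_equal; lia. Qed.

Lemma index_S n : index (S n) = (index n + 1)%Z.
Proof. unfold index; lia. Qed.

Lemma phase_continuous k v t : admissible D k v -> continuous (fun s => phase k v s k) t.
Proof.
  intros [d [Hd [Hl [Hlast [Hr Hu]]]]].
  apply (ex_derive_continuous (fun s => phase k v s k)).
  eexists; now apply phase_derive with D d.
Qed.

Lemma phase_init k v j : admissible D k v -> phase k v 0 j = v j.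
Proof. intros [d [Hd [Hl [Hlast [Hr Hu]]]]]; now apply phase_0 with d. Qed.

Lemma phase_init_neg k v : admissible D k v -> phase k v 0 k < 0.
Proof.
  intros Ha; rewrite phase_init by assumption.
  destruct Ha as [d [Hd [_ [_ [Hr _]]]]]; specialize (Hr k ltac:(lia)); lra.
Qed.

(** Specification of one step of [stage], made so that case analysis delivers the hitting data
    together with the new state. *)
Inductive phase_end (k : Z) (v : Z -> R) (tau : R) :
  option (R * (Z -> R)) -> Prop :=
| phase_stops h : 0 < h -> (forall s, 0 <= s < h -> phase k v s k < 0) ->
    phase k v h k = 0 -> phase_end k v tau (Some (tau + h, phase k v h))
| phase_lasts : (forall s, 0 <= s -> phase k v s k < 0) -> phase_end k v tau None.

Lemma stage_S_end n tau v : stage n = Some (tau, v) -> admissible D (index n) v ->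
  phase_end (index n) v tau (stage (S n)).
Proof.
  intros Hn Ha; simpl; rewrite Hn.
  set (f := fun s => phase (index n) v s (index n)).
  assert (Hf : forall t, continuous f t) by (intros; now apply phase_continuous).
  assert (Hf0 : f 0 < 0) by now apply phase_init_neg.
  pose proof (crossing_lower f) as Hlow.
  pose proof (crossing_pos f Hf Hf0) as Hpos.
  pose proof (crossing_zero f Hf Hf0) as Hzero.
  destruct (crossing f) as [h| |].
  - apply phase_stops; [exact Hpos| |exact (Hzero h eq_refl)].
    intros s Hs; apply Hlow; simpl; lra.
  - apply phase_lasts; intros s Hs; now apply Hlow.
  - destruct Hpos.
Qed.

(** [D] passes unchanged through every transition, while the margin hidden in [admissible] may
    shrink each time; no uniform margin over all phases is claimed. *)
Lemma stage_invariant n tau v : stage n = Some (tau, v) ->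
  0 <= tau /\ admissible D (index n) v.
Proof.
  revert tau v; induction n as [|n IH]; intros tau v Hn.
  - injection Hn as <- <-; unfold index; rewrite Z.add_0_r; split; [lra | exact Hadm].
  - destruct (stage n) as [[tau' v']|] eqn:E; [|simpl in Hn; rewrite E in Hn; discriminate].
    destruct (IH tau' v' eq_refl) as [Ht Ha].
    pose proof (stage_S_end n tau' v' E Ha) as He; rewrite Hn in He.
    inversion He as [h Hh Hb Hz Heq|].
    split; [lra|]; rewrite index_S.
    destruct Ha as [d [Hd [Hl [Hlast [Hr Hu]]]]].
    now apply hit_admissible with d.
Qed.

Lemma end_time_finite n tau v t : stage n = Some (tau, v) -> end_time n = Finite t ->
  tau < t /\ stage (S n) = Some (t, phase (index n) v (t - tau)) /\
  (forall s, 0 <= s < t - tau -> phase (index n) v s (index n) < 0) /\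
  phase (index n) v (t - tau) (index n) = 0.
Proof.
  intros Hn Ht; destruct (stage_invariant n tau v Hn) as [_ Ha].
  unfold end_time in Ht.
  destruct (stage_S_end n tau v Hn Ha) as [h Hh Hb Hz|]; [|discriminate].
  injection Ht as <-; replace (tau + h - tau) with h by ring.
  repeat split; auto; lra.
Qed.

Lemma end_time_gt n tau v : stage n = Some (tau, v) -> Rbar_lt tau (end_time n).
Proof.
  intros Hn; destruct (end_time n) as [t| |] eqn:E; [|exact I|].
  - now apply (end_time_finite n tau v t).
  - unfold end_time in E; destruct (stage (S n)) as [[? ?]|]; discriminate.
Qed.

Lemma before_end n tau v s : stage n = Some (tau, v) -> 0 <= s ->
  Rbar_lt (tau + s) (end_time n) -> phase (index n) v s (index n) < 0.
Proof.
  intros Hn Hs Hlt; destruct (stage_invariant n tau v Hn) as [_ Ha].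
  unfold end_time in Hlt.
  destruct (stage_S_end n tau v Hn Ha) as [h Hh Hb Hz|Hb]; [|auto].
  apply Hb; simpl in Hlt; lra.
Qed.

Lemma upto_end n tau v s : stage n = Some (tau, v) -> 0 <= s ->
  Rbar_le (tau + s) (end_time n) -> phase (index n) v s (index n) <= 0.
Proof.
  intros Hn Hs [Hlt|Heq]%Rbar_le_lt_or_eq_dec.
  - left; now apply before_end with tau.
  - symmetry in Heq; destruct (end_time_finite n tau v _ Hn Heq) as [_ [_ [_ Hz]]].
    replace (tau + s - tau) with s in Hz by ring; lra.
Qed.

Lemma stage_last n tau v : stage (S n) = Some (tau, v) -> v (index (S n) - 1)%Z = 0.
Proof.
  intros Hn; destruct (stage n) as [[tau' v']|] eqn:E; [|simpl in Hn; rewrite E in Hn; discriminate].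
  destruct (stage_invariant n tau' v' E) as [_ Ha].
  pose proof (stage_S_end n tau' v' E Ha) as He; rewrite Hn in He.
  inversion He as [h Hh Hb Hz Heq|].
  rewrite index_S; replace (index n + 1 - 1)%Z with (index n) by lia; assumption.
Qed.

Lemma stage_S_inv n tau v : stage (S n) = Some (tau, v) ->
  exists tau' v', stage n = Some (tau', v') /\ end_time n = Finite tau /\
    tau' < tau /\ v = phase (index n) v' (tau - tau').
Proof.
  intros Hn; destruct (stage n) as [[tau' v']|] eqn:E; [|simpl in Hn; rewrite E in Hn; discriminate].
  assert (He : end_time n = Finite tau) by (unfold end_time; now rewrite Hn).
  destruct (end_time_finite n tau' v' tau E He) as [H1 [H2 _]].
  exists tau', v'; repeat split; try assumption; congruence.
Qed.

Lemma stage_wait n tau v t : stage (S n) = Some (tau, v) -> end_time (S n) = Finite t ->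
  2 < D /\ ln (sqrt ((D + 2) / (D - 2))) <= t - tau.
Proof.
  intros Hn Ht; destruct (end_time_finite _ _ _ _ Hn Ht) as [Hlt [_ [Hb Hz]]].
  destruct (stage_invariant _ _ _ Hn) as [_ [d [Hd [Hl [Hlast [Hr Hu]]]]]].
  apply hit_wait with (k := index (S n)) (v := v) (d := d); try assumption.
  - lra.
  - now apply stage_last with tau.
Qed.

(** The first phase has no minimal length, because site [k1 - 1] need not start from 0; the count
    therefore begins with the second phase. *)
Lemma stage_growth : exists w, 0 < w /\
  forall n tau v, stage (S n) = Some (tau, v) -> INR n * w <= tau.
Proof.
  (* If [D = 2], [stage_wait] excludes a second transition, so any positive value serves. *)
  exists (if Rlt_dec 2 D then ln (sqrt ((D + 2) / (D - 2))) else 1).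
  set (w := if Rlt_dec 2 D then ln (sqrt ((D + 2) / (D - 2))) else 1).
  split.
  - unfold w; destruct (Rlt_dec 2 D) as [H2|]; [|lra].
    rewrite <- ln_1; apply ln_increasing; [lra|].
    rewrite <- sqrt_1; apply sqrt_lt_1_alt; split; [lra|].
    apply Rmult_lt_reg_r with (D - 2); [lra|].
    unfold Rdiv; rewrite Rmult_assoc, Rinv_l; lra.
  - induction n as [|n IH]; intros tau v Hn.
    + simpl; rewrite Rmult_0_l; apply (stage_invariant _ _ _ Hn).
    + destruct (stage_S_inv _ _ _ Hn) as [tau' [v' [Hn' [He _]]]].
      specialize (IH _ _ Hn').
      destruct (stage_wait n tau' v' tau Hn' He) as [H2 Hw].
      unfold w in *; destruct (Rlt_dec 2 D); [|contradiction].
      rewrite S_INR; lra.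
Qed.

(** If no phase contained [t], every phase would be reached by time [t], against [stage_growth]. *)
Lemma stage_cover t : 0 <= t -> exists n tau v,
  stage n = Some (tau, v) /\ tau <= t /\ Rbar_lt t (end_time n).
Proof.
  intros Ht; apply Classical_Prop.NNPP; intros Hno.
  assert (Hall : forall n, exists tau v, stage n = Some (tau, v) /\ tau <= t).
  { induction n as [|n [tau [v [Hn Hle]]]]; [exists 0, u0; split; [reflexivity | lra]|].
    destruct (Rbar_lt_dec t (end_time n)) as [Hlt|Hge].
    - exfalso; apply Hno; exists n, tau, v; auto.
    - apply Rbar_not_lt_le in Hge.
      pose proof (end_time_gt n tau v Hn) as Hgt.
      destruct (end_time n) as [T| |] eqn:E; try easy.
      exists T, (phase (index n) v (T - tau)); split; [|exact Hge].
      now apply end_time_finite. }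
  destruct stage_growth as [w [Hw Hgrow]].
  destruct (INR_unbounded (t / w)) as [n Hn].
  destruct (Hall (S n)) as [tau [v [Hs Hle]]].
  specialize (Hgrow n tau v Hs).
  apply (Rmult_gt_compat_r w) in Hn; [|assumption].
  unfold Rdiv in Hn; rewrite Rmult_assoc, Rinv_l in Hn; lra.
Qed.

Lemma stage_lt n m tau v : (n < m)%nat -> stage m = Some (tau, v) -> Rbar_le (end_time n) tau.
Proof.
  intros Hnm; revert tau v; induction Hnm as [|m Hnm IH]; intros tau v Hm.
  - destruct (stage_S_inv _ _ _ Hm) as [tau' [v' [_ [-> _]]]]; apply Rbar_le_refl.
  - destruct (stage_S_inv _ _ _ Hm) as [tau' [v' [Hm' [_ [Hlt _]]]]].
    apply Rbar_le_trans with (1 := IH _ _ Hm'); simpl; lra.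
Qed.

(** Searches downwards from [n] for the last phase begun by time [t]. No fixed [n] need serve all
    times, so [evolution_exists] lets it depend on [t]. *)
Fixpoint glue (n : nat) (t : R) : Z -> R :=
  match n with
  | O => phase k1 u0 t
  | S m =>
    match stage (S m) with
    | Some (tau, v) => if Rle_dec tau t then phase (index (S m)) v (t - tau) else glue m t
    | None => glue m t
    end
  end.

Lemma glue_stage N n tau v t : stage n = Some (tau, v) -> tau <= t ->
  Rbar_lt t (end_time n) -> (n <= N)%nat -> glue N t = phase (index n) v (t - tau).
Proof.
  intros Hn Hle Hlt HnN; induction N as [|N IH].
  - replace n with 0%nat in * by lia; injection Hn as <- <-.
    simpl; unfold index; now rewrite Z.add_0_r, Rminus_0_r.
  - destruct (Nat.eq_dec n (S N)) as [->|Hne].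
    + unfold glue; fold glue; rewrite Hn; now destruct Rle_dec.
    + simpl glue; destruct (stage (S N)) as [[tau' v']|] eqn:E.
      * simpl in E; rewrite E; destruct Rle_dec as [Hle'|]; [exfalso|apply IH; lia].
        apply (Rbar_lt_not_le _ _ Hlt).
        apply Rbar_le_trans with (Finite tau'); [|exact Hle'].
        apply stage_lt with (S N) v'; [lia | exact E].
      * simpl in E; rewrite E; apply IH; lia.
Qed.

Lemma evolution_exists : exists u : R -> Z -> R, forall n tau v t,
  stage n = Some (tau, v) -> tau <= t -> Rbar_lt t (end_time n) ->
  u t = phase (index n) v (t - tau).
Proof.
  destruct stage_growth as [w [Hw Hgrow]].
  (* Phase [S m] starts no earlier than [m * w], so only [m <= t / w] can have started by time
     [t]. *)
  exists (fun t => glue (S (Z.to_nat (up (t / w)))) t); intros n tau v t Hn Hle Hlt.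
  apply glue_stage; try assumption.
  destruct n as [|n]; [lia|].
  specialize (Hgrow n tau v Hn).
  apply le_n_S, Nat2Z.inj_le.
  enough (Z.of_nat n < up (t / w))%Z by lia.
  apply lt_IZR; rewrite <- INR_IZR_INZ.
  apply Rle_lt_trans with (t / w); [|apply archimed].
  apply Rmult_le_reg_r with w; [assumption|].
  unfold Rdiv; rewrite Rmult_assoc, Rinv_l; lra.
Qed.

(** * Properties of the glued evolution *)

Section Evolution.

Variable u : R -> Z -> R.
Hypothesis Hu : forall n tau v t, stage n = Some (tau, v) -> tau <= t ->
  Rbar_lt t (end_time n) -> u t = phase (index n) v (t - tau).

Lemma evolution_stage n tau v : stage n = Some (tau, v) -> forall j, u tau j = v j.
Proof.
  intros Hn j; rewrite (Hu n tau v tau Hn (Rle_refl _) (end_time_gt n tau v Hn)).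
  rewrite Rminus_eq_0; apply phase_init, (stage_invariant n tau v Hn).
Qed.

(** At the end time [u] is given by the next phase, whose initial state is by construction the final
    state of this one. *)
Lemma evolution_closed n tau v t j : stage n = Some (tau, v) -> tau <= t ->
  Rbar_le t (end_time n) -> u t j = phase (index n) v (t - tau) j.
Proof.
  intros Hn Hle [Hlt|Heq]%Rbar_le_lt_or_eq_dec; [now rewrite (Hu n tau v t)|].
  symmetry in Heq; destruct (end_time_finite n tau v t Hn Heq) as [_ [HS _]].
  now rewrite (evolution_stage _ _ _ HS).
Qed.

Lemma evolution_0 j : u 0 j = u0 j.
Proof. now apply (evolution_stage 0 0 u0). Qed.

Lemma evolution_bounds n tau v t j : stage n = Some (tau, v) -> tau <= t ->
  Rbar_le t (end_time n) ->
  ((j < index n)%Z -> 0 <= u t j) /\ -2 <= u t j <= D.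
Proof.
  intros Hn Hle Hend; rewrite (evolution_closed n tau v t j) by assumption.
  assert (Hneg : forall s, 0 <= s <= t - tau -> phase (index n) v s (index n) <= 0).
  { intros s Hs; apply upto_end with tau; [assumption | lra|].
    apply Rbar_le_trans with (2 := Hend); simpl; lra. }
  destruct (stage_invariant _ _ _ Hn) as [_ [d [Hd [Hl [Hlast [Hr Hup]]]]]].
  assert (Hpos : (j < index n)%Z -> 0 <= phase (index n) v (t - tau) j).
  { intros Hj; destruct (Z.eq_dec j (index n - 1)) as [->|Hne].
    - apply phase_last with D d; try assumption; lra.
    - apply Rle_trans with (d * exp (- (2 * (t - tau)))).
      + left; apply Rmult_lt_0_compat; [assumption | apply exp_pos].
      + apply phase_left with D; try assumption; [lia | lra]. }
  split; [exact Hpos|split].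
  - destruct (Z_lt_dec j (index n)) as [Hj|Hj]; [specialize (Hpos Hj); lra|].
    apply Rle_trans with (-2 + d * exp (- (2 * (t - tau)))).
    + enough (0 < d * exp (- (2 * (t - tau)))) by lra.
      apply Rmult_lt_0_compat; [assumption | apply exp_pos].
    + apply phase_right_ge with D; try assumption; [lia | lra].
  - apply phase_le with d (t - tau); try assumption; lra.
Qed.

Lemma evolution_le t j : 0 <= t -> u t j <= D.
Proof.
  intros Ht; destruct (stage_cover t Ht) as [n [tau [v [Hn [Hle Hlt]]]]].
  apply (evolution_bounds n tau v t j Hn Hle (Rbar_lt_le _ _ Hlt)).
Qed.

Lemma evolution_bounded t : 0 <= t -> bounded_by D (u t).
Proof.
  intros Ht j; destruct (stage_cover t Ht) as [n [tau [v [Hn [Hle Hlt]]]]].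
  destruct (evolution_bounds n tau v t j Hn Hle (Rbar_lt_le _ _ Hlt)) as [_ H].
  apply Rabs_le; lra.
Qed.

Lemma phase_lipschitz n tau v s t j : stage n = Some (tau, v) -> 0 <= s -> 0 <= t ->
  Rabs (phase (index n) v s j - phase (index n) v t j) <= 4 * D * Rabs (s - t).
Proof.
  intros Hn Hs Ht; destruct (stage_invariant _ _ _ Hn) as [_ [d [Hd [Hl [Hlast [Hr Hup]]]]]].
  unfold phase; match goal with |- Rabs (?a + ?c - (?b + ?c)) <= _ =>
    replace (a + c - (b + c)) with (a - b) by ring end.
  apply heat_lipschitz; try assumption.
  now apply dPhi_bounded with (index n) d.
Qed.

(** The Lipschitz constant is the same in all phases, so the estimates on [[s, tau]] and [[tau, t]]
    add up without loss. *)
Lemma evolution_lipschitz_stage n : forall tau v s t j, stage n = Some (tau, v) ->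
  tau <= t -> Rbar_le t (end_time n) -> 0 <= s <= t ->
  Rabs (u s j - u t j) <= 4 * D * Rabs (s - t).
Proof.
  induction n as [|n IH]; intros tau v s t j Hn Hle Hend Hs.
  - pose proof Hn as H0; injection H0 as <- _.
    rewrite (evolution_closed 0 0 v t j), (evolution_closed 0 0 v s j) by
      (try assumption; try lra; apply Rbar_le_trans with (2 := Hend); apply Hs).
    replace (s - t) with (s - 0 - (t - 0)) by ring.
    apply phase_lipschitz with 0; try assumption; lra.
  - assert (Hclose : forall r, tau <= r <= t -> Rabs (u r j - u t j) <= 4 * D * Rabs (r - t)).
    { intros r Hr.
      rewrite (evolution_closed (S n) tau v t j), (evolution_closed (S n) tau v r j) by
        (try assumption; try lra; apply Rbar_le_trans with (2 := Hend); apply Hr).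
      replace (r - t) with (r - tau - (t - tau)) by ring.
      apply phase_lipschitz with tau; try assumption; lra. }
    destruct (Rle_dec tau s) as [Hts|Hts]; [apply Hclose; lra|].
    destruct (stage_S_inv _ _ _ Hn) as [tau' [v' [Hn' [He [Hlt _]]]]].
    assert (H1 := IH tau' v' s tau j Hn' ltac:(lra) ltac:(rewrite He; apply Rbar_le_refl) ltac:(lra)).
    assert (H2 := Hclose tau ltac:(lra)).
    replace (u s j - u t j) with ((u s j - u tau j) + (u tau j - u t j)) by ring.
    eapply Rle_trans; [apply Rabs_triang|].
    rewrite (Rabs_left1 (s - tau)) in H1 by lra.
    rewrite (Rabs_left1 (tau - t)) in H2 by lra.
    rewrite (Rabs_left1 (s - t)) by lra; lra.
Qed.

Lemma evolution_lipschitz s t j : 0 <= s -> 0 <= t ->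
  Rabs (u s j - u t j) <= 4 * D * Rabs (s - t).
Proof.
  assert (H : forall s t, 0 <= s <= t -> Rabs (u s j - u t j) <= 4 * D * Rabs (s - t)).
  { intros r t' Hr; destruct (stage_cover t' ltac:(lra)) as [n [tau [v [Hn [Hle Hlt]]]]].
    apply evolution_lipschitz_stage with n tau v; try assumption.
    now apply Rbar_lt_le. }
  intros Hs Ht; destruct (Rle_dec s t); [apply H; lra|].
  rewrite Rabs_minus_sym, (Rabs_minus_sym s); apply H; lra.
Qed.

Lemma evolution_continuous : continuous_linf u.
Proof.
  apply continuous_linf_lipschitz with D (4 * D).
  - exact evolution_bounded.
  - intros; now apply evolution_lipschitz.
Qed.

Lemma evolution_dPhi n tau v t j : stage n = Some (tau, v) -> tau <= t ->
  Rbar_lt t (end_time n) -> dPhi (u t j) = heat (fun i => dPhi (v i)) (t - tau) j.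
Proof.
  intros Hn Hle Hlt; rewrite (Hu n tau v t) by assumption.
  destruct (stage_invariant _ _ _ Hn) as [_ [d [Hd [Hl [Hlast [Hr Hup]]]]]].
  apply phase_dPhi with D d; try assumption; [|lra].
  intros r Hr'; apply before_end with tau; [assumption | lra|].
  apply Rbar_le_lt_trans with (2 := Hlt); simpl; lra.
Qed.

Lemma evolution_rhs n tau v t j : stage n = Some (tau, v) -> tau <= t ->
  Rbar_lt t (end_time n) -> rhs (u t) j = Lap (heat (fun i => dPhi (v i)) (t - tau)) j.
Proof.
  intros Hn Hle Hlt; unfold rhs, Lap.
  now rewrite !(evolution_dPhi n tau v) by assumption.
Qed.

Lemma phase_shift_derive n tau v t j : stage n = Some (tau, v) ->
  is_derive (fun s => phase (index n) v (s - tau) j) t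
    (Lap (heat (fun i => dPhi (v i)) (t - tau)) j).
Proof.
  intros Hn; destruct (stage_invariant _ _ _ Hn) as [_ [d [Hd [Hl [Hlast [Hr Hup]]]]]].
  pose proof (phase_derive D (index n) v d HD Hd Hl Hlast Hr Hup j (t - tau)) as H.
  rewrite <- Rmult_1_l.
  apply (is_derive_comp (fun s => phase (index n) v s j) (fun s => s - tau)); [exact H|].
  auto_derive; [trivial | ring].
Qed.

Lemma locally_lt_Rbar (t : R) (b : Rbar) : Rbar_lt t b -> locally t (fun s : R => Rbar_lt s b).
Proof. intros H; now apply (open_Rbar_lt' t b). Qed.

(** At the start of a later phase the formula holds on the right only, hence [tau < t]; at time 0
    [deriv_at] is itself one-sided. *)
Lemma evolution_deriv n tau v t j : stage n = Some (tau, v) -> tau < t \/ t = 0 /\ tau = 0 ->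
  Rbar_lt t (end_time n) -> deriv_at (fun s => u s j) t (rhs (u t) j).
Proof.
  intros Hn Ht Hlt; destruct (stage_invariant _ _ _ Hn) as [Ht0 _].
  rewrite (evolution_rhs n tau v) by (try assumption; lra).
  apply deriv_at_intro with (fun s => phase (index n) v (s - tau) j).
  - lra.
  - now apply phase_shift_derive.
  - assert (H1 : locally t (fun s => 0 <= s -> tau <= s)).
    { destruct Ht as [Ht|[-> ->]].
      - apply filter_imp with (fun s => tau < s); [intros s Hs _; lra|].
        now apply (open_gt tau).
      - now apply filter_forall. }
    apply filter_imp with (2 := filter_and _ _ H1 (locally_lt_Rbar t _ Hlt)).
    intros s [Hs1 Hs2] Hs0; rewrite (Hu n tau v s); auto.
Qed.

Lemma heat_lap_continuous n tau v t j : stage n = Some (tau, v) ->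
  continuous (fun s => Lap (heat (fun i => dPhi (v i)) (s - tau)) j) t.
Proof.
  intros Hn; destruct (stage_invariant _ _ _ Hn) as [_ [d [Hd [Hl [Hlast [Hr Hup]]]]]].
  assert (Hb : bounded_by D (fun i => dPhi (v i))) by now apply dPhi_bounded with (index n) d.
  assert (Hc : forall i, ex_derive (fun s => heat (fun i => dPhi (v i)) (s - tau) i) t).
  { intros i; eexists.
    apply (is_derive_comp (fun s => heat (fun i => dPhi (v i)) s i) (fun s => s - tau)).
    - now apply heat_derive with D.
    - auto_derive; [trivial | reflexivity]. }
  apply (ex_derive_continuous (fun s => Lap (heat (fun i => dPhi (v i)) (s - tau)) j)).
  unfold Lap.
  apply (ex_derive_plus (fun s => heat (fun i => dPhi (v i)) (s - tau) (j + 1)%Z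
     - 2 * heat (fun i => dPhi (v i)) (s - tau) j)); [|apply Hc].
  apply (ex_derive_minus (fun s => heat (fun i => dPhi (v i)) (s - tau) (j + 1)%Z)); [apply Hc|].
  apply (ex_derive_scal (fun s => heat (fun i => dPhi (v i)) (s - tau) j)), Hc.
Qed.

Lemma t_prev_index n : t_prev k1 times (index n) =
  match stage n with Some (tau, _) => Finite tau | None => p_infty end.
Proof.
  unfold t_prev; destruct Z.eq_dec as [He|Hne].
  - replace n with 0%nat by (unfold index in He; lia); reflexivity.
  - destruct n as [|n]; [unfold index in Hne; lia|].
    replace (index (S n) - 1)%Z with (index n) by (rewrite index_S; lia).
    apply times_index.
Qed.

Lemma index_nat k : (k1 <= k)%Z -> exists n, k = index n.
Proof. intros Hk; exists (Z.to_nat (k - k1)); unfold index; lia. Qed.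

Lemma evolution_X n tau v t : stage n = Some (tau, v) -> tau < t ->
  Rbar_lt t (end_time n) -> X (index n) (u t).
Proof.
  intros Hn Hlt Hend; rewrite (Hu n tau v t) by (try assumption; lra).
  assert (Hneg : forall s, 0 <= s <= t - tau -> phase (index n) v s (index n) < 0).
  { intros s Hs; apply before_end with tau; [assumption | lra|].
    apply Rbar_le_lt_trans with (2 := Hend); simpl; lra. }
  destruct (stage_invariant _ _ _ Hn) as [_ [d [Hd [Hl [Hlast [Hr Hup]]]]]].
  destruct (phase_separated D (index n) v d HD Hd Hl Hlast Hr Hup (t - tau) Hneg ltac:(lra))
    as [e [He [Hl' Hr']]].
  now apply X_intro with e D.
Qed.

Lemma evolution_neg n tau v t j : stage n = Some (tau, v) -> tau <= t ->
  Rbar_lt t (end_time n) -> (index n <= j)%Z -> u t j < 0.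
Proof.
  intros Hn [Hlt|<-] Hend Hj.
  - apply X_neg with (index n); [now apply evolution_X with tau v | assumption].
  - rewrite (evolution_stage n tau v Hn).
    destruct (stage_invariant _ _ _ Hn) as [_ [d [Hd [_ [_ [Hr _]]]]]].
    specialize (Hr j Hj); lra.
Qed.

Lemma end_time_stage n t : end_time n = Finite t -> exists tau v tau' v',
  stage n = Some (tau, v) /\ stage (S n) = Some (tau', v') /\ tau' = t.
Proof.
  unfold end_time; destruct (stage (S n)) as [[tau' v']|] eqn:E; [|discriminate].
  intros He; injection He as <-.
  destruct (stage_S_inv _ _ _ E) as [tau [v [H _]]].
  exists tau, v, tau', v'; auto.
Qed.

(** The state at [t] has two descriptions: as the start of phase [S n] it yields the right limit of
    the velocity, as the end of phase [n] the left limit. *)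
Lemma transition_facts n t : end_time n = Finite t ->
  u t (index n) = 0 /\
  u t (index n - 1)%Z > 2 /\
  deriv_lim (at_right t) (fun s => u s (index n)) (rhs (u t) (index n)) /\
  (exists l, deriv_lim (at_left t) (fun s => u s (index n)) l /\
     rhs (u t) (index n) = 4 + l) /\
  4 <= rhs (u t) (index n).
Proof.
  intros He; destruct (end_time_stage n t He) as [tau [v [t' [v' [Hn [HS ->]]]]]].
  destruct (end_time_finite n tau v t Hn He) as [Hlt [HS' [Hb Hz]]].
  rewrite HS in HS'; injection HS' as ->.
  pose proof (stage_invariant _ _ _ Hn) as [Ht0 [d [Hd [Hl [Hlast [Hr Hup]]]]]].
  assert (Hut : u t = phase (index n) v (t - tau)).
  { rewrite (Hu _ _ _ t HS (Rle_refl t) (end_time_gt _ _ _ HS)), Rminus_eq_0.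
    apply FunctionalExtensionality.functional_extensionality; intros j.
    apply phase_init, (stage_invariant _ _ _ HS). }
  assert (Hrhs : rhs (u t) (index n) =
      4 + Lap (heat (fun i => dPhi (v i)) (t - tau)) (index n)).
  { rewrite Hut; apply hit_rhs with D d; try assumption; lra. }
  split; [now rewrite Hut|split; [|split; [|split]]].
  - rewrite Hut; apply hit_left with D d; try assumption; lra.
  - exists (fun s => rhs (u s) (index n)).
    assert (Hnear : at_right t (fun s => t < s /\ Rbar_lt s (end_time (S n)))).
    { apply filter_imp with (2 := locally_lt_Rbar t _ (end_time_gt _ _ _ HS)); auto. }
    split.
    + apply filter_imp with (2 := Hnear); intros s [Hs1 Hs2].
      eapply evolution_deriv; [exact HS | now left | exact Hs2].
    + rewrite (evolution_rhs _ _ _ t (index n) HS (Rle_refl t) (end_time_gt _ _ _ HS)).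
      eapply filterlim_ext_loc.
      * apply filter_imp with (2 := Hnear); intros s [Hs1 Hs2].
        symmetry; apply (evolution_rhs _ _ _ s (index n) HS); [lra | exact Hs2].
      * eapply filterlim_filter_le_1; [apply filter_le_within|].
        apply (heat_lap_continuous _ _ _ t (index n) HS).
  - exists (Lap (heat (fun i => dPhi (v i)) (t - tau)) (index n)); split; [|exact Hrhs].
    exists (fun s => rhs (u s) (index n)).
    assert (Hnear : at_left t (fun s => tau < s /\ Rbar_lt s (end_time n))).
    { apply filter_imp with (2 := open_gt tau t Hlt); rewrite He; auto. }
    split.
    + apply filter_imp with (2 := Hnear); intros s [Hs1 Hs2].
      eapply evolution_deriv; [exact Hn | now left | exact Hs2].
    + eapply filterlim_ext_loc.
      * apply filter_imp with (2 := Hnear); intros s [Hs1 Hs2].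
        symmetry; apply (evolution_rhs _ _ _ s (index n) Hn); [lra | exact Hs2].
      * eapply filterlim_filter_le_1; [apply filter_le_within|].
        apply (heat_lap_continuous _ _ _ t (index n) Hn).
  - rewrite Hut; apply hit_rhs_ge with D d; try assumption; lra.
Qed.

Lemma evolution_single_interface : single_interface k1 u times.
Proof.
  split.
  - exact evolution_continuous.
  - intros k Hk; destruct (index_nat k Hk) as [n ->]; rewrite times_index.
    destruct (stage n) as [[tau v]|] eqn:E.
    + apply Rbar_le_lt_trans with (Finite tau); [apply (stage_invariant _ _ _ E)|].
      now apply end_time_gt with v.
    + unfold end_time; simpl; now rewrite E.
  - intros k Hk; destruct (index_nat k Hk) as [n ->]; rewrite times_index, t_prev_index.
    destruct (stage n) as [[tau v]|] eqn:E; [right | now left].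
    now apply end_time_gt with v.
  - intros j t Ht Hne; destruct (stage_cover t Ht) as [n [tau [v [Hn [Hle Hlt]]]]].
    apply evolution_deriv with n tau v; try assumption.
    destruct Hle as [Hle|Heq]; [now left|].
    (* A phase other than the first that starts exactly at [t] would make [t] a transition time. *)
    destruct n as [|n]; [right; injection Hn as <- _; now split|exfalso].
    destruct (stage_S_inv _ _ _ Hn) as [tau' [v' [_ [He _]]]].
    apply (Hne (index n)); [unfold index; lia|].
    rewrite times_index, He; now f_equal.
  - intros k tk Hk HT; destruct (index_nat k Hk) as [n ->]; rewrite times_index in HT.
    destruct (transition_facts n tk HT) as [H0 [_ [Hr [_ H4]]]].
    split; [exact H0|]; eexists; split; [exact Hr | lra].
  - intros k Hk; destruct (index_nat k Hk) as [n ->]; rewrite times_index, t_prev_index.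
    destruct (stage n) as [[tau v]|] eqn:E; [intros _ t | easy].
    intros H1 H2; now apply evolution_X with tau v.
Qed.

(** * Uniqueness *)

Section Uniqueness.

Variables (u' : R -> Z -> R) (T' : Z -> Rbar).
Hypothesis Hsi : single_interface k1 u' T'.
Hypothesis Hinit : forall j, u' 0 j = u0 j.

(** Up to [b], no later than either end of the phase, both solutions have the signs of [X k], so
    their difference solves the homogeneous heat equation with zero initial data. *)
Lemma agree_on_phase n tau v b : stage n = Some (tau, v) ->
  (forall j, u' tau j = v j) -> t_prev k1 T' (index n) = Finite tau ->
  (forall k, (k1 <= k < index n)%Z -> Rbar_le (T' k) tau) ->
  tau <= b -> Rbar_le b (end_time n) -> Rbar_le b (T' (index n)) ->
  forall t j, tau <= t <= b -> u' t j = u t j.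
Proof.
  intros Hn Hv Hprev Hpast Htb HbT HbT' t j Ht.
  rewrite (evolution_closed n tau v t j) by
    (try assumption; try lra; apply Rbar_le_trans with (2 := HbT); apply Ht).
  destruct (stage_invariant _ _ _ Hn) as [Ht0 [d [Hd [Hl [Hlast [Hr Hup]]]]]].
  pose proof (si_continuous _ _ _ Hsi) as Hc.
  destruct (linf_bounded_Icc u' tau b Hc Ht0 Htb) as [C HC].
  set (k := index n) in *.
  set (w := fun s i => phase k v (s - tau) i).
  assert (HX : forall s, tau < s < b -> X k (u' s)).
  { intros s Hs; apply (si_phase _ _ _ Hsi k); [unfold k, index; lia| | |]; rewrite ?Hprev.
    - exact I.
    - apply Hs.
    - apply Rbar_lt_le_trans with (Finite b); [apply Hs | exact HbT']. }
  assert (Hd' : forall s i, tau < s < b -> is_derive (fun r => u' r i) s (rhs (u' s) i)).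
  { intros s i Hs; apply deriv_at_elim; [lra|].
    (* No transition of [u'] falls inside: those before [k] are over by [tau], and a later one would
       put a zero at a site where [X k] requires a negative value. *)
    apply (si_equation _ _ _ Hsi); [lra|]; intros m Hm Hms.
    destruct (Z_lt_dec m k) as [Hmk|Hmk].
    - specialize (Hpast m ltac:(lia)); rewrite Hms in Hpast; simpl in Hpast; lra.
    - destruct (si_transition _ _ _ Hsi m s Hm Hms) as [H0 _].
      pose proof (X_neg k (u' s) m (HX s Hs) ltac:(lia)); lra. }
  assert (HdW : forall s i, is_derive (fun r => w r i) s
                              (Lap (heat (fun i => dPhi (v i)) (s - tau)) i))
    by (intros; now apply phase_shift_derive).
  assert (Hrhs : forall s i, tau < s < b -> rhs (u' s) i = 
     Lap (u' s) i - Lap (phase_sgn k) i).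
  { intros s i Hs; destruct (X_elim k _ (HX s Hs)) as [e [He [Hxl Hxr]]].
    assert (Hx : forall m, dPhi (u' s m) = u' s m - phase_sgn k m).
    { intros m; apply dPhi_phase; intros Hm.
      - specialize (Hxl m Hm); lra.
      - specialize (Hxr m Hm); lra. }
    unfold rhs, Lap; rewrite !Hx; ring. }
  assert (Hw : forall s i, Lap (heat (fun i => dPhi (v i)) (s - tau)) i =
     Lap (w s) i - Lap (phase_sgn k) i) by (intros; unfold w, phase, Lap; ring).
  assert (Hbw : forall s i, tau <= s <= b -> Rabs (w s i) <= D).
  { intros s i Hs; unfold w, k; rewrite <- (evolution_closed n tau v s i) by
      (try assumption; try lra; apply Rbar_le_trans with (2 := HbT); apply Hs).
    apply evolution_bounded; lra. }
  assert (Hcu : forall i, continuous_on (Icc tau b) (fun s => u' s i))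
    by (intros i; now apply linf_continuous_on).
  (* The difference and its negative are both nonnegative by comparison. *)
  assert (Hsign : forall a, a = 1 \/ a = -1 -> 0 <= a * (u' t j - w t j)).
  { intros a Ha.
    apply (comparison_nonneg (fun _ => True) tau b (C + D)
      (fun s i => a * (u' s i - w s i))
      (fun s i => a * (rhs (u' s) i - Lap (heat (fun i => dPhi (v i)) (s - tau)) i))).
    - intros i _ s Hs.
      assert (Hcw : continuous_on (Icc tau b) (fun s => w s i))
        by (eapply continuous_on_of_derive; intros r; apply HdW).
      apply (filterlim_comp _ _ _ (fun s => u' s i - w s i) (fun x => a * x) _
               (locally (u' s i - w s i))).
      + apply (filterlim_comp_2 (G := locally (u' s i)) (H := locally (- w s i))
                 (fun s => u' s i) (fun s => - w s i) Rplus).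
        * now apply Hcu.
        * apply (filterlim_comp _ _ _ (fun s => w s i) Ropp _ (locally (w s i))).
          -- now apply Hcw.
          -- apply (filterlim_opp (w s i)).
        * apply (filterlim_plus (u' s i) (- w s i)).
      + apply (filterlim_scal_r (K := R_AbsRing) (V := R_NormedModule) a (u' s i - w s i)).
    - intros i s _ Hs; split.
      + apply (is_derive_scal (fun r => u' r i - w r i)).
        apply (is_derive_minus (fun r => u' r i) (fun r => w r i)); [now apply Hd' | apply HdW].
      + rewrite Hrhs, Hw by assumption; unfold Lap; lra.
    - intros i s Hi; now destruct Hi.
    - intros i _; unfold w; rewrite Rminus_eq_0.
      rewrite (phase_0 k v d) by assumption; rewrite Hv; lra.
    - intros i s Hs; specialize (HC s Hs i); specialize (Hbw s i Hs).
      apply Rabs_le_between in HC; apply Rabs_le_between in Hbw.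
      destruct Ha as [-> | ->]; lra.
    - exact Ht. }
  pose proof (Hsign 1 ltac:(now left)); pose proof (Hsign (-1) ltac:(now right)).
  fold (w t j); lra.
Qed.

(** If the times differed, then at the earlier one, up to which the solutions agree, site [index n]
    would be 0 for one solution and negative for the other. *)
Lemma next_time_agrees n tau v : stage n = Some (tau, v) ->
  (forall j, u' tau j = v j) -> t_prev k1 T' (index n) = Finite tau ->
  (forall k, (k1 <= k < index n)%Z -> Rbar_le (T' k) tau) ->
  T' (index n) = end_time n.
Proof.
  intros Hn Hv Hprev Hpast.
  assert (Hk : (k1 <= index n)%Z) by (unfold index; lia).
  pose proof (end_time_gt n tau v Hn) as Hend.
  assert (Hend' : Rbar_lt tau (T' (index n))).
  { destruct (si_increasing _ _ _ Hsi (index n) Hk) as [H|H]; rewrite Hprev in H;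
      [discriminate | exact H]. }
  destruct (stage_invariant _ _ _ Hn) as [Ht0 _].
  destruct (Rbar_total_order (T' (index n)) (end_time n)) as [[Hlt|Heq]|Hlt]; [exfalso| exact Heq |exfalso].
  - destruct (T' (index n)) as [b| |] eqn:E; try easy; simpl in Hend'.
    destruct (si_transition _ _ _ Hsi (index n) b Hk E) as [H0 _].
    rewrite (agree_on_phase n tau v b) in H0; try assumption; try lra.
    + pose proof (evolution_neg n tau v b (index n) Hn ltac:(lra) Hlt ltac:(lia)); lra.
    + now apply Rbar_lt_le.
    + rewrite E; apply Rbar_le_refl.
  - destruct (end_time n) as [b| |] eqn:E; try easy; simpl in Hend.
    destruct (transition_facts n b E) as [H0 _].
    rewrite <- (agree_on_phase n tau v b) in H0; try assumption; try lra.
    + enough (u' b (index n) < 0) by lra.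
      apply X_neg with (index n); [|lia].
      apply (si_phase _ _ _ Hsi); rewrite ?Hprev; [exact Hk | exact I | exact Hend | exact Hlt].
    + rewrite E; apply Rbar_le_refl.
    + now apply Rbar_lt_le.
Qed.

Lemma agree_until_stage n : forall tau v, stage n = Some (tau, v) ->
  (forall j, u' tau j = v j) /\ t_prev k1 T' (index n) = Finite tau /\
  (forall k, (k1 <= k < index n)%Z -> Rbar_le (T' k) tau) /\
  (forall t j, 0 <= t <= tau -> u' t j = u t j).
Proof.
  induction n as [|n IH]; intros tau v Hn.
  - pose proof Hn as H0; injection H0 as <- <-; split; [exact Hinit|split; [|split]].
    + unfold t_prev; destruct Z.eq_dec as [|Hne]; [reflexivity | unfold index in Hne; lia].
    + intros k Hk; unfold index in Hk; lia.
    + intros t j Ht; replace t with 0 by lra; now rewrite evolution_0.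
  - destruct (stage_S_inv _ _ _ Hn) as [tau' [v' [Hn' [He [Hlt _]]]]].
    destruct (IH tau' v' Hn') as [Hv [Hprev [Hpast Hold]]].
    pose proof (next_time_agrees n tau' v' Hn' Hv Hprev Hpast) as HT; rewrite He in HT.
    assert (Hnew : forall t j, tau' <= t <= tau -> u' t j = u t j).
    { apply (agree_on_phase n tau' v' tau); try assumption; try lra.
      - rewrite He; apply Rbar_le_refl.
      - rewrite HT; apply Rbar_le_refl. }
    split; [|split; [|split]].
    + intros j; rewrite Hnew by lra; now apply (evolution_stage (S n)).
    + unfold t_prev; destruct Z.eq_dec as [Heq|_]; [unfold index in Heq; lia|].
      rewrite index_S; replace (index n + 1 - 1)%Z with (index n) by lia; exact HT.
    + intros k Hk; rewrite index_S in Hk; destruct (Z.eq_dec k (index n)) as [->|Hne].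
      * rewrite HT; apply Rbar_le_refl.
      * apply Rbar_le_trans with (Finite tau'); [apply Hpast; lia | simpl; lra].
    + intros t j Ht; destruct (Rle_dec t tau'); [apply Hold | apply Hnew]; lra.
Qed.

Lemma evolution_unique t j : 0 <= t -> u' t j = u t j.
Proof.
  intros Ht; destruct (stage_cover t Ht) as [n [tau [v [Hn [Hle Hlt]]]]].
  destruct (agree_until_stage n tau v Hn) as [Hv [Hprev [Hpast _]]].
  apply (agree_on_phase n tau v t); try assumption; try lra.
  - now apply Rbar_lt_le.
  - rewrite (next_time_agrees n tau v) by assumption; now apply Rbar_lt_le.
Qed.

Lemma times_unique k : (k1 <= k)%Z -> T' k = times k.
Proof.
  intros Hk; destruct (index_nat k Hk) as [n ->]; rewrite times_index.
  destruct (stage n) as [[tau v]|] eqn:E.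
  - destruct (agree_until_stage n tau v E) as [Hv [Hprev [Hpast _]]].
    now apply next_time_agrees with tau v.
  - replace (end_time n) with p_infty by (unfold end_time; simpl; now rewrite E).
    pose proof (si_pos _ _ _ Hsi _ Hk) as Hpos.
    (* Phase [n] is never reached, so at a finite [t] some phase [m <= n] of [u] is running and site
       [index n] is negative, whereas a transition of [u'] requires 0 there. *)
    destruct (T' (index n)) as [t| |] eqn:ET; [exfalso | reflexivity | easy].
    simpl in Hpos.
    destruct (si_transition _ _ _ Hsi (index n) t Hk ET) as [H0 _].
    rewrite evolution_unique in H0 by lra.
    destruct (stage_cover t ltac:(lra)) as [m [tau [v [Hm [Hle Hlt]]]]].
    enough (u t (index n) < 0) by lra.
    apply (evolution_neg m tau v); try assumption.
    assert (Hmn : (m <= n)%nat); [|unfold index; lia].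
    apply Nat.nlt_ge; intros Hnm; clear -Hnm Hm E HD Hadm.
    revert tau v Hm; induction Hnm as [|m _ IH]; intros tau v Hm.
    + simpl in Hm; rewrite E in Hm; discriminate.
    + destruct (stage_S_inv _ _ _ Hm) as [tau' [v' [Hm' _]]]; eauto.
Qed.

End Uniqueness.

End Evolution.

End Stages.

(** * Starting index and conclusion *)

(** The signs of the initial data determine the index. Membership in [X k1'] is granted only for
    positive times, so signs are compared at a small one, where each value has moved by at most half
    the initial margin. *)
Lemma initial_index_unique k1 k1' u' T' u0 : X k1 u0 -> single_interface k1' u' T' ->
  (forall j, u' 0 j = u0 j) -> k1' = k1.
Proof.
  intros HX Hsi Hinit.
  destruct (X_elim k1 u0 HX) as [e [He [Hl Hr]]].
  pose proof (si_pos _ _ _ Hsi k1' ltac:(lia)) as Hpos.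
  assert (Hnear : forall j, exists s, X k1' (u' s) /\ Rabs (u' s j - u0 j) <= e / 2).
  { intros j; destruct (linf_locally u' 0 (si_continuous _ _ _ Hsi) (Rle_refl 0) (e / 2))
      as [d [Hd0 Hd]]; [lra|].
    destruct (locally_lt_Rbar 0 _ Hpos) as [d' Hd'].
    pose proof (cond_pos d').
    assert (Hm : 0 < Rmin d d') by (apply Rmin_pos; lra).
    pose proof (Rmin_l d d'); pose proof (Rmin_r d d').
    assert (Hs : Rabs (Rmin d d' / 2 - 0) < Rmin d d') by (rewrite Rabs_right; lra).
    exists (Rmin d d' / 2); split.
    - apply (si_phase _ _ _ Hsi k1'); [lia| | |];
        unfold t_prev; try (destruct Z.eq_dec; [|lia]); simpl; try easy; [lra|].
      apply Hd'; change (Rabs (Rmin d d' / 2 - 0) < d'); lra.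
    - rewrite <- Hinit; apply Hd; lra. }
  destruct (Z.lt_trichotomy k1' k1) as [Hlt|[Heq|Hlt]]; [exfalso| exact Heq |exfalso].
  - destruct (Hnear k1') as [s [HXs Hs]].
    pose proof (X_neg k1' _ k1' HXs ltac:(lia)); specialize (Hl k1' Hlt).
    apply Rabs_le_between in Hs; lra.
  - destruct (Hnear k1) as [s [HXs Hs]].
    destruct (X_elim _ _ HXs) as [e' [He' [Hl' _]]]; specialize (Hl' k1 Hlt).
    specialize (Hr k1 ltac:(lia)); apply Rabs_le_between in Hs; lra.
Qed.

Theorem theorem3p2 (k1 : Z) (u0 : Z -> R) (Hu0 : X k1 u0) :
  exists (u : R -> Z -> R) (T : Z -> Rbar),
    single_interface k1 u T /\
    (forall j, u 0 j = u0 j) /\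
    (forall (k1' : Z) (u' : R -> Z -> R) (T' : Z -> Rbar),
       single_interface k1' u' T' ->
       (forall j, u' 0 j = u0 j) ->
       k1' = k1 /\
       (forall t j, 0 <= t -> u' t j = u t j) /\
       (forall k, (k1 <= k)%Z -> T' k = T k)) /\
    Rbar_le (Rbar_lub (fun x => exists t, 0 <= t /\ x = sup_all (u t)))
            (upper (u 0)) /\
    (forall (k : Z) (tk : R), (k1 <= k)%Z -> T k = Finite tk ->
       u tk (k - 1)%Z > 2 /\
       Rbar_le (waiting_time (upper (u 0)))
               (Rbar_minus (T (k + 1)%Z) (T k)) /\
       deriv_lim (at_right tk) (fun s => u s k) (rhs (u tk) k) /\
       (exists l, deriv_lim (at_left tk) (fun s => u s k) l /\
                  rhs (u tk) k = 4 + l) /\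
       rhs (u tk) k >= 4).
Proof.
  set (D := upper u0).
  assert (HD : 2 <= D) by apply Rmax_l.
  assert (Hadm : admissible D k1 u0) by now apply X_admissible.
  destruct (evolution_exists D k1 u0 HD Hadm) as [u Hu].
  pose proof (evolution_0 D k1 u0 HD Hadm u Hu) as Hu00.
  assert (HuD : upper (u 0) = D).
  { unfold D; f_equal; now apply FunctionalExtensionality.functional_extensionality. }
  exists u, (times k1 u0); rewrite HuD.
  split; [now apply evolution_single_interface with D|].
  split; [exact Hu00|split; [|split]].
  - intros k1' u' T' Hsi Hinit.
    assert (k1' = k1) as -> by now apply (initial_index_unique k1 k1' u' T' u0).
    split; [reflexivity|split].
    + intros t j Ht; now apply (evolution_unique D k1 u0 HD Hadm u Hu u' T').
    + intros k Hk; now apply (times_unique D k1 u0 HD Hadm u Hu u' T').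
  - unfold Rbar_lub; destruct Rbar_ex_lub as [l [Hub Hl]]; simpl proj1_sig.
    apply Hl; intros x [t [Ht ->]]; apply sup_on_le; intros j _.
    now apply (evolution_le D k1 u0).
  - intros k tk Hk HT.
    destruct (index_nat k1 k Hk) as [n ->].
    rewrite <- index_S; rewrite !times_index in *; rewrite HT.
    destruct (transition_facts D k1 u0 HD Hadm u Hu n tk HT) as [_ [H2 [Hr [Hlim H4]]]].
    split; [exact H2|split; [|split; [exact Hr|split; [exact Hlim | lra]]]].
    destruct (end_time_stage D k1 u0 HD Hadm n tk HT) as [tau [v [t' [v' [Hn [HS ->]]]]]].
    (* A finite next transition forces [2 < D], so the infinite waiting time occurs only when the
       next phase lasts forever. *)
    destruct (end_time k1 u0 (S n)) as [t2| |] eqn:E.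
    + destruct (stage_wait D k1 u0 HD Hadm n tk v' t2 HS E) as [HD2 Hw].
      unfold waiting_time; destruct Req_EM_T as [Heq|_]; [lra | exact Hw].
    + unfold waiting_time; destruct Req_EM_T; exact I.
    + pose proof (end_time_gt D k1 u0 HD Hadm _ _ _ HS) as Hgt; rewrite E in Hgt; destruct Hgt.
Qed.
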